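(* For every integer $n>0$ there exists a compact connected symplectic manifold $(Z,\omega)$ of (real) dimension $4n$ whose boundary $\partial Z$ is disconnected and of contact type.
   Context: The boundary $\partial Z$ of a symplectic manifold $(Z,\omega)$ is said to have contact type if there is a vector field $X$, defined on a neighborhood of $\partial Z$, which is conformal symplectic in the sense that $\mathcal{L}_X\omega = d(i_X\omega)=\omega$, and which is everywhere transverse to $\partial Z$ and points outwards along $\partial Z$. *)

(* Defs.v *)
From HB Require Import structures.
From mathcomp Require Import all_boot all_order all_algebra.
From mathcomp Require Import all_classical all_reals all_analysis.

Set Implicit Arguments.
Unset Strict Implicit.
Unset Printing Implicit Defensive.

Import Order.TTheory GRing.Theory Num.Theory.
Import numFieldNormedType.Exports.

Local Open Scope classical_set_scope.
Local Open Scope ring_scope.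

Section Calculus.
Variables (R : realType) (m : nat).
Implicit Types (x : 'rV[R]_m) (A U : set 'rV[R]_m).

Fixpoint Ck_on (W : normedModType R) (k : nat) U (f : 'rV[R]_m -> W) : Prop :=
  if k is k'.+1 then
    (forall x, U x -> differentiable f x) /\
    (forall v : 'rV[R]_m, Ck_on k' U (fun x => 'D_v f x))
  else forall x, U x -> {for x, continuous f}.

(* Smoothness on a set A that need not be open: local extendability. *)
Definition smooth_on (W : normedModType R) A (f : 'rV[R]_m -> W) : Prop :=
  forall x, A x -> exists (U : set 'rV[R]_m) (F : 'rV[R]_m -> W),
    [/\ open U, U x, forall k, Ck_on k U F & forall y, A y -> U y -> F y = f y].

(* The condition i = 0 :> nat selects the first coordinate; when m = 0 there
   is none, and the half-space is the point. *)
Definition half_space : set 'rV[R]_m :=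
  [set x | forall i : 'I_m, i = 0%N :> nat -> 0 <= x 0 i].

Definition half_space_boundary : set 'rV[R]_m :=
  [set x | exists2 i : 'I_m, i = 0%N :> nat & x 0 i = 0].

(* The i-th partial derivative relative to the half-space: two-sided, except
   that at the boundary it is one-sided in the first coordinate. *)
Definition partial (f : 'rV[R]_m -> R) (i : 'I_m) x : R :=
  lim ((fun h : R => h^-1 * (f (x + h *: delta_mx 0 i) - f x)) @
       within [set h | half_space (x + h *: delta_mx 0 i)] 0^').

(* Row-vector convention: a tangent vector v at x is sent to v *m Jac f x. *)
Definition Jac (f : 'rV[R]_m -> 'rV[R]_m) x : 'M[R]_m :=
  \matrix_(i, j) partial (fun y => f y 0 j) i x.

(* In coordinates, a vector field X and a 1-form a are the rows of their
   components X^i and a_i, and a 2-form w is the matrix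
   w_ij = w(d/dx_i, d/dx_j). *)

Definition contract (X : 'rV[R]_m -> 'rV[R]_m) (w : 'rV[R]_m -> 'M[R]_m) :
  'rV[R]_m -> 'rV[R]_m := fun x => X x *m w x.

Definition d1 (a : 'rV[R]_m -> 'rV[R]_m) x : 'M[R]_m :=
  \matrix_(i, j) (partial (fun y => a y 0 j) i x - partial (fun y => a y 0 i) j x).

Definition d2 (w : 'rV[R]_m -> 'M[R]_m) x (i j k : 'I_m) : R :=
  partial (fun y => w y j k) i x + partial (fun y => w y k i) j x
  + partial (fun y => w y i j) k x.

Definition Lie (X : 'rV[R]_m -> 'rV[R]_m) (w : 'rV[R]_m -> 'M[R]_m) x : 'M[R]_m :=
  \matrix_(i, j) \sum_(k < m)
    (X x 0 k * partial (fun y => w y i j) k x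
     + w x k j * partial (fun y => X y 0 k) i x
     + w x i k * partial (fun y => X y 0 k) j x).

End Calculus.

Arguments half_space {R m}.
Arguments half_space_boundary {R m}.

(* The values of chart_map outside chart_dom, and of chart_inv outside the
   image of chart_dom, are irrelevant. *)
Record chart (R : realType) (m : nat) (Z : topologicalType) := Chart {
  chart_dom : set Z;
  chart_map : Z -> 'rV[R]_m;
  chart_inv : 'rV[R]_m -> Z;
  chart_dom_open : open chart_dom;
  chart_mapK : forall p, chart_dom p -> chart_inv (chart_map p) = p;
  chart_range_open : exists2 W : set 'rV[R]_m, open W &
    chart_map @` chart_dom = W `&` half_space;
  chart_map_continuous : {within chart_dom, continuous chart_map};
  chart_inv_continuous :
    {within chart_map @` chart_dom, continuous chart_inv} }.

Definition transition (R : realType) (m : nat) (Z : topologicalType)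
    (c c' : chart R m Z) : 'rV[R]_m -> 'rV[R]_m :=
  fun x => chart_map c' (chart_inv c x).

(* Smooth m-dimensional manifolds with (possibly empty) boundary. *)
Record manifold (R : realType) (m : nat) := Manifold {
  carrier :> topologicalType;
  atlas : set (chart R m carrier);
  manifold_hausdorff : hausdorff_space carrier;
  manifold_second_countable : @second_countable carrier;
  atlas_cover : forall p, exists2 c, atlas c & chart_dom c p;
  atlas_compatible : forall c c', atlas c -> atlas c' ->
    smooth_on (chart_map c @` (chart_dom c `&` chart_dom c'))
              (transition c c') }.

Section Tensors.
Variables (R : realType) (m : nat) (Z : manifold R m).

Definition boundary : set Z :=
  [set p | exists c, [/\ atlas c, chart_dom c p &
                         half_space_boundary (chart_map c p)]].

(* Tensor fields are given by their components in each chart of the atlas, as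
   functions of the coordinates, subject to the usual transformation law. *)

Definition is_two_form (w : chart R m Z -> 'rV[R]_m -> 'M[R]_m) : Prop :=
  [/\ forall c, atlas c -> smooth_on (chart_map c @` chart_dom c) (w c),
      forall c p, atlas c -> chart_dom c p ->
        (w c (chart_map c p))^T = - w c (chart_map c p) &
      forall c c' p, atlas c -> atlas c' -> chart_dom c p -> chart_dom c' p ->
        let J := Jac (transition c c') (chart_map c p) in
        w c (chart_map c p) = J *m w c' (chart_map c' p) *m J^T].

Definition symplectic (w : chart R m Z -> 'rV[R]_m -> 'M[R]_m) : Prop :=
  [/\ is_two_form w,
      forall c p, atlas c -> chart_dom c p ->
        forall i j k, d2 (w c) (chart_map c p) i j k = 0 &
      forall c p, atlas c -> chart_dom c p -> w c (chart_map c p) \in unitmx].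

Definition is_vector_field_on (U : set Z)
    (X : chart R m Z -> 'rV[R]_m -> 'rV[R]_m) : Prop :=
  (forall c, atlas c -> smooth_on (chart_map c @` (chart_dom c `&` U)) (X c)) /\
  (forall c c' p, atlas c -> atlas c' -> chart_dom c p -> chart_dom c' p -> U p ->
     X c' (chart_map c' p) =
     X c (chart_map c p) *m Jac (transition c c') (chart_map c p)).

Definition conformal_symplectic_on (U : set Z)
    (w : chart R m Z -> 'rV[R]_m -> 'M[R]_m)
    (X : chart R m Z -> 'rV[R]_m -> 'rV[R]_m) : Prop :=
  forall c p, atlas c -> chart_dom c p -> U p ->
    Lie (X c) (w c) (chart_map c p) = d1 (contract (X c) (w c)) (chart_map c p) /\
    d1 (contract (X c) (w c)) (chart_map c p) = w c (chart_map c p).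

(* Charts take values in x_0 >= 0, and the tangent space of the boundary is
   v_0 = 0: transverse means v_0 <> 0, and outward-pointing means v_0 < 0. *)
Definition transverse_outward
    (X : chart R m Z -> 'rV[R]_m -> 'rV[R]_m) : Prop :=
  forall c p, atlas c -> chart_dom c p -> boundary p ->
    forall i : 'I_m, i = 0%N :> nat -> X c (chart_map c p) 0 i < 0.

Definition boundary_of_contact_type
    (w : chart R m Z -> 'rV[R]_m -> 'M[R]_m) : Prop :=
  exists (U : set Z) (X : chart R m Z -> 'rV[R]_m -> 'rV[R]_m),
    [/\ open U, boundary `<=` U, is_vector_field_on U X,
        conformal_symplectic_on U w X & transverse_outward X].

End Tensors.

Arguments boundary {R m} Z.

(* Main.v *)
Require Import Defs.
From mathcomp Require Import all_boot all_order all_algebra.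
From mathcomp Require Import all_classical all_reals all_analysis.
From mathcomp Require Import ring lra zify.

Set Implicit Arguments.
Unset Strict Implicit.
Unset Printing Implicit Defensive.

Import Order.TTheory GRing.Theory Num.Theory.
Import numFieldNormedType.Exports.

Local Open Scope classical_set_scope.
Local Open Scope ring_scope.

(** Fix [k = 2n] and let [u, y] be coordinates on [R^k x R^k]. On the strip
[0 <= u_0 <= 2] consider the Liouville form [lambda = sum_j P_j(u) dy_j] with
<<
  P_0 = (u_0 - 1) e^{-(u_1 + ... + u_{k-1})},    P_j = e^{u_j}  (0 < j < k).
>>
The matrix of partial derivatives of [P] is triangular with nonzero diagonal,
so [omega = d lambda] is symplectic. The vector field
[X = k (u_0 - 1) d/du_0 + sum_{j > 0} d/du_j] satisfies [X P_j = P_j], that is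
[i_X omega = lambda], hence [L_X omega = d (i_X omega) = omega]; and it points
out of the strip along both [u_0 = 0] and [u_0 = 2], because it expands
[u_0 - 1]. So the strip is a Liouville domain with two boundary components,
except that it is not compact. It remains to find a discrete group which
preserves [lambda] and acts freely, properly discontinuously and cocompactly.

Translating [u_1, ..., u_{k-1}] by [a] multiplies [P_j] by the exponential of
a linear form [w_j(a)] (lemma [weightD]), with [w_0 + ... + w_{k-1} = 0].
Therefore [(u, y) |-> (u + a, e^{-w(a)} y + b)] preserves [lambda]
([deck_symmetry]). Such maps form a group as soon as [a] ranges over a lattice
of rank [k - 1] and [b] over a lattice of rank [k] which is stable under the
diagonal matrices [e^{w(a)}]. Arithmetic provides both. The polynomial
[f = prod_{i < k} (x - 3i) - 1] has [k] real roots [r_j], with [r_j] at distance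
at most 1 from [3j]. In [Z[x]/(f)] the elements [x - 3i] are units, their
product being 1. Take for [b] the vectors [(Q(r_j))_j] with [Q] in [Z[x]], a
lattice with a Vandermonde basis ([fiber_latticeE]). Take for [a] the vectors
such that both [e^{w(a)}] and [e^{-w(a)}] are of the form [(Q(r_j))_j]. These
[a] are discrete since the [b] are, and they contain the vectors of logarithms
of the units [(x - 3i)^2]. The matrix of these logarithms is diagonally
dominant ([log_unit_mx_unit]): [|r_j - 3i| > 1] for [i <> j], while for each [j]
the logarithms add up to 0. So the [a] have full rank.

The quotient of the strip is the wanted manifold. Its charts are local sections
of the projection, composed near the end [u_0 = 2] with the involution
[(u_0, y_0) |-> (2 - u_0, - y_0)], which exchanges the two ends and preserves
[lambda]. Consequently all the transition functions are locally affine maps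
that preserve [omega] and [X] ([transition_affine]), and the symplectic form
and the Liouville field are given by the same formulas in every chart. *)

(** * Smoothness of elementary functions *)

Section Elementary.
Variables (R : realType) (m : nat).
Implicit Types (f g : 'rV[R]_m -> R) (x v : 'rV[R]_m).

(** The class is closed under differentiation, so its members are
smooth; it contains the coefficients of all the tensors and affine maps below. *)
Inductive elementary : ('rV[R]_m -> R) -> Prop :=
| elementary_cst c : elementary (cst c)
| elementary_coord i : elementary (fun x => x 0 i)
| elementaryD f g : elementary f -> elementary g -> elementary (f + g)
| elementaryM f g : elementary f -> elementary g -> elementary (f * g)
| elementary_exp f : elementary f -> elementary (expR \o f).

Lemma is_diff_expR (y : R) : is_diff y expR (fun h => h * expR y).
Proof.
have de : differentiable (@expR R) y by exact/derivable1_diffP/derivable_expR.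
apply: DiffDef => //; apply/funext => h.
by rewrite diff1E// derive1E derive_val.
Qed.

Lemma is_derive_coord x v i : is_derive x v (fun y : 'rV[R]_m => y 0 i) (v 0 i).
Proof.
apply: DeriveDef; first exact/diff_derivable/differentiable_coord.
rewrite deriveE; last exact: differentiable_coord.
have @L : {linear 'rV[R]_m -> R}.
  by exists (fun N : 'rV[R]_m => N 0 i); do 2![eexists]; do ?[constructor];
     rewrite ?mxE// => ? *; rewrite ?mxE//; move=> ?; rewrite !mxE.
rewrite (_ : (fun y : 'rV_m => y 0 i) = L) // diff_lin //; exact: coord_continuous.
Qed.

Lemma is_derive_exp f x v df : differentiable f x -> is_derive x v f df ->
  is_derive x v (fun y => expR (f y)) (df * expR (f x)).
Proof.
move=> dfx [_ fd]; have de := @is_diff_expR (f x).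
have dc : differentiable (expR \o f) x.
  by apply: differentiable_comp => //; exact: ex_diff.
apply: DeriveDef; first exact: diff_derivable.
by rewrite deriveE// diff_comp//= diff_val -deriveE// fd.
Qed.

Lemma elementary_differentiable f x : elementary f -> differentiable f x.
Proof.
elim=> {f} [c|i|f g _ df _ dg|f g _ df _ dg|f _ df].
- exact: differentiable_cst.
- exact: differentiable_coord.
- exact: differentiableD.
- exact: differentiableM.
- apply: differentiable_comp => //; exact/derivable1_diffP/derivable_expR.
Qed.

Lemma elementary_derive f v : elementary f -> elementary (fun x => 'D_v f x).
Proof.
elim=> {f} [c|i|f g ef df eg dg|f g ef df eg dg|f ef df].
- rewrite (_ : (fun x => _) = cst 0); first exact: elementary_cst.
  by apply/funext => x; rewrite derive_cst.
- rewrite (_ : (fun x => _) = cst (v 0 i)); first exact: elementary_cst.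
  by apply/funext => x; have [_ ->] := @is_derive_coord x v i.
- rewrite (_ : (fun x => _) = (fun x => 'D_v f x) + (fun x => 'D_v g x)).
    exact: elementaryD.
  by apply/funext => x; rewrite deriveD//; apply/diff_derivable;
    apply: elementary_differentiable.
- rewrite (_ : (fun x => _) = f * (fun x => 'D_v g x) + g * (fun x => 'D_v f x)).
    by apply: elementaryD; apply: elementaryM.
  by apply/funext => x; rewrite deriveM//; apply/diff_derivable;
    apply: elementary_differentiable.
- rewrite (_ : (fun x => _) = (fun x => 'D_v f x) * (expR \o f)).
    by apply: elementaryM => //; apply: elementary_exp.
  apply/funext => x; have dfx := elementary_differentiable x ef.
  by have [_ ->] := is_derive_exp dfx (derivableP (diff_derivable (v := v) dfx)).
Qed.

Lemma differentiable_mx p q (f : 'rV[R]_m -> 'M[R]_(p, q)) x :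
  (forall i j, differentiable (fun y => f y i j) x) -> differentiable f x.
Proof.
move=> df.
rewrite (_ : f = \sum_i \sum_j (fun y => f y i j *: delta_mx i j)); last first.
  apply/funext => y; rewrite fct_sumE [LHS]matrix_sum_delta.
  by apply: eq_bigr => i _; rewrite fct_sumE.
apply: differentiable_sum => i; apply: differentiable_sum => j.
exact: differentiableZl.
Qed.

Lemma elementary_Ck p q (f : 'rV[R]_m -> 'M[R]_(p, q)) k U :
  (forall i j, elementary (fun y => f y i j)) -> Ck_on k U f.
Proof.
elim: k f => [|k IH] f ef /=.
  move=> x _; apply: differentiable_continuous; apply: differentiable_mx => i j.
  exact: elementary_differentiable.
have df x : differentiable f x.
  by apply: differentiable_mx => i j; exact: elementary_differentiable.
split=> [x _|v]; first exact: df.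
apply: IH => i j.
rewrite (_ : (fun y => _) = (fun x => 'D_v (fun y => f y i j) x)).
  exact: elementary_derive.
apply/funext => x; rewrite derive_mx ?mxE//; exact/diff_derivable.
Qed.

Lemma elementary_smooth p q (f : 'rV[R]_m -> 'M[R]_(p, q)) A :
  (forall i j, elementary (fun y => f y i j)) -> smooth_on A f.
Proof.
move=> ef x _; exists setT, f; split=> //; first exact: openT.
by move=> k; exact: elementary_Ck.
Qed.

Lemma elementary_eq f g : elementary f -> f =1 g -> elementary g.
Proof. by move=> ef /funext <-. Qed.

Lemma elementary_sum I (r : seq I) (P : pred I) (F : I -> 'rV[R]_m -> R) :
  (forall i, elementary (F i)) -> elementary (fun x => \sum_(i <- r | P i) F i x).
Proof.
move=> eF; rewrite (_ : (fun x => _) = \sum_(i <- r | P i) F i).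
  by apply: big_ind => //; [exact: elementary_cst | exact: elementaryD].
by apply/funext => x; rewrite fct_sumE.
Qed.

Lemma elementary_continuous p q (f : 'rV[R]_m -> 'M[R]_(p, q)) :
  (forall i j, elementary (fun y => f y i j)) -> continuous f.
Proof.
move=> ef x; apply: differentiable_continuous; apply: differentiable_mx => i j.
exact: elementary_differentiable.
Qed.

Lemma elementary_affine q (M : 'M[R]_(m, q)) (c : 'rV[R]_q) i j :
  elementary (fun x : 'rV[R]_m => (x *m M + c) i j).
Proof.
apply: (@elementary_eq ((fun x => \sum_l x 0 l * M l j) + cst (c 0 j))).
  apply: elementaryD; last exact: elementary_cst.
  apply: elementary_sum => l.
  by apply: elementaryM; [exact: elementary_coord|exact: elementary_cst].
by move=> y; rewrite ord1 !mxE.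
Qed.

End Elementary.

(** * One-sided partial derivatives on the half-space *)

Section Partial.
Variables (R : realType) (m : nat).
Implicit Types (f g : 'rV[R]_m -> R) (x v : 'rV[R]_m).

(** At a point of the half-space one can always move in the positive
direction, so the filter that defines the one-sided derivative is proper. *)
Lemma half_space_near_proper x (i : 'I_m) : half_space x ->
  ProperFilter (within [set h : R | half_space (x + h *: delta_mx 0 i)] 0^').
Proof.
move=> hx; apply: Build_ProperFilter_ex => A.
rewrite /within/= => /nbhs_ballP[e e0 /= H].
exists (e / 2); apply: H.
- by rewrite /ball/= sub0r normrN gtr0_norm ?divr_gt0// ltr_pdivrMr// ltr_pMr// ltr1n.
- by rewrite gt_eqF// divr_gt0.
- by move=> j j0; rewrite !mxE addr_ge0 ?hx// mulr_ge0 ?divr_ge0 ?(ltW e0)//.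
Qed.

Lemma partialE f (i : 'I_m) x : half_space x -> differentiable f x ->
  partial f i x = 'D_(delta_mx 0 i) f x.
Proof.
move=> hx dfx; have PF := half_space_near_proper i hx.
rewrite /partial; apply: cvg_lim => //.
apply: (@cvg_within_filter _ _ _ _ (dnbhs_filter _)).
have /cvg_ex[/= l hl] := diff_derivable (v := delta_mx 0 i) dfx.
rewrite /derive (cvg_lim _ hl)//; apply: cvg_trans hl.
rewrite (_ : (fun h => _) = (fun h => h^-1 *: ((f \o shift x) (h *: delta_mx 0 i) - f x)))//.
by apply/funext => h /=; rewrite [x + _]addrC.
Qed.

(** The one-sided derivative only sees the points of the half-space; this
matters for transition functions, which are arbitrary elsewhere. *)
Lemma eq_near_partial f g (i : 'I_m) x : half_space x ->
  (\forall y \near x, half_space y -> f y = g y) -> partial f i x = partial g i x.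
Proof.
move=> hx fg; rewrite /partial; congr (lim _).
have E : \forall h \near (0:R)^', half_space (x + h *: delta_mx 0 i) ->
    f (x + h *: delta_mx 0 i) = g (x + h *: delta_mx 0 i).
  have c : (x + h *: delta_mx 0 i) @[h --> (0:R)^'] --> x.
    rewrite -[X in _ --> X]addr0; apply: cvgD; first exact: cvg_cst.
    rewrite -(scale0r (delta_mx 0 i)); apply: cvgZr_tmp => /=.
    exact: cvg_within.
  exact: (c _ fg).
have fgx := nbhs_singleton fg hx.
apply/seteqP; split=> A; rewrite /nbhs/= /within/=; apply: filterS2 E => h + H hh.
  by move=> <- //; rewrite -fgx; exact: H.
by move=> -> //; rewrite fgx; exact: H.
Qed.

Lemma Jac_near_affine (f : 'rV[R]_m -> 'rV[R]_m) (M : 'M[R]_m) (c : 'rV[R]_m) x :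
  half_space x -> (\forall y \near x, half_space y -> f y = y *m M + c) ->
  Jac f x = M.
Proof.
move=> hx fE; apply/matrixP => i j; rewrite mxE.
pose g (y : 'rV[R]_m) := (y *m M + c) 0 j.
rewrite (@eq_near_partial _ g)//; last first.
  by apply: filterS fE => y fE /fE ->.
rewrite partialE//; last exact/elementary_differentiable/elementary_affine.
have -> : g = (\sum_l (M l j *: (fun y : 'rV[R]_m => y 0 l))) + cst (c 0 j).
  apply/funext => y; rewrite /g /= !mxE !fctE fct_sumE; congr (_ + _).
  by apply: eq_bigr => l _; rewrite mulrC.
have dc := @is_derive_coord R m x (delta_mx 0 i).
have -> : 'D_(delta_mx 0 i)
    ((\sum_l (M l j *: (fun y : 'rV[R]_m => y 0 l))) + cst (c 0 j)) x =
    \sum_l M l j *: (delta_mx 0 i : 'rV[R]_m) 0 l + 0.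
  by apply: derive_val.
rewrite addr0 (bigD1 i)//= mxE !eqxx/= big1 ?addr0 ?/GRing.scale/= ?mulr1// => l li.
by rewrite mxE (negbTE li)/= mulr0.
Qed.

End Partial.

(** * The Liouville form, its differential and its symmetries *)

Section Liouville.
Variables (R : realType) (k' : nat).
Notation k := k'.+1.
Implicit Types (x : 'rV[R]_(k + k)) (v u a : 'rV[R]_k) (i j l : 'I_k).

(** Column [j] holds the coefficients of the linear form by which a
translation rescales the [j]-th momentum: minus the sum of the other
coordinates for [j = 0], and the [j]-th coordinate otherwise. *)
Definition weight_mx : 'M[R]_k :=
  \matrix_(i, j) if j == 0 then - (i != 0)%:R else (i == j)%:R.
Definition weight u j : R := (u *m weight_mx) 0 j.

Definition amplitude u j : R := if j == 0 then u 0 0 - 1 else 1.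

Definition momentum x : 'rV[R]_k :=
  \row_j (amplitude (lsubmx x) j * expR (weight (lsubmx x) j)).

Definition momentum_jac x : 'M[R]_k :=
  \matrix_(i, j) ((((i == 0) && (j == 0))%:R + amplitude (lsubmx x) j * weight_mx i j)
   * expR (weight (lsubmx x) j)).

Definition liouville_form x : 'rV[R]_(k + k) := row_mx 0 (momentum x).

Definition symplectic_form x : 'M[R]_(k + k) :=
  block_mx 0 (momentum_jac x) (- (momentum_jac x)^T) 0.

Definition radial u : 'rV[R]_k := \row_i (if i == 0 then k%:R * (u 0 0 - 1) else 1).
Definition liouville_field x : 'rV[R]_(k + k) := row_mx (radial (lsubmx x)) 0.

Lemma elementary_weight j : elementary (fun x => weight (lsubmx x) j).
Proof.
apply: (@elementary_eq _ _ (fun x => \sum_i x 0 (lshift k i) * weight_mx i j)).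
  apply: elementary_sum => i.
  by apply: elementaryM; [exact: elementary_coord|exact: elementary_cst].
by move=> x; rewrite /weight mxE; apply: eq_bigr => i _; rewrite [lsubmx x _ _]mxE.
Qed.

Lemma elementary_u0 : elementary (fun x => (lsubmx x) 0 0 - 1 : R).
Proof.
apply: (@elementary_eq _ _ ((fun x => x 0 (lshift k (0 : 'I_k))) + cst (-1))).
  by apply: elementaryD; [exact: elementary_coord|exact: elementary_cst].
by move=> x; rewrite !mxE.
Qed.

Lemma elementary_amplitude j : elementary (fun x => amplitude (lsubmx x) j).
Proof.
rewrite /amplitude; case: (j == 0); [exact: elementary_u0|exact: elementary_cst].
Qed.

Lemma elementary_momentum j : elementary (fun x => momentum x 0 j).
Proof.
apply: (elementary_eq (elementaryM (elementary_amplitude j)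
  (elementary_exp (elementary_weight j)))).
by move=> x; rewrite mxE.
Qed.

Lemma elementary_momentum_jac i j : elementary (fun x => momentum_jac x i j).
Proof.
apply: (elementary_eq (elementaryM
  (elementaryD (elementary_cst _ ((i == 0) && (j == 0))%:R)
    (elementaryM (elementary_amplitude j) (elementary_cst _ (weight_mx i j))))
  (elementary_exp (elementary_weight j)))).
by move=> x; rewrite [RHS]mxE.
Qed.

Lemma elementary_liouville_form (i : 'I_1) (j : 'I_(k + k)) :
  elementary (fun x => liouville_form x i j).
Proof.
rewrite ord1; case: (split_ordP j) => l ->.
  by apply: (elementary_eq (elementary_cst _ 0)) => x; rewrite row_mxEl mxE.
by apply: (elementary_eq (elementary_momentum l)) => x; rewrite row_mxEr.
Qed.

Lemma elementary_symplectic_form (i j : 'I_(k + k)) :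
  elementary (fun x => symplectic_form x i j).
Proof.
case: (split_ordP i) => a ->; case: (split_ordP j) => b ->.
- by apply: (elementary_eq (elementary_cst _ 0)) => x; rewrite block_mxEul mxE.
- by apply: (elementary_eq (elementary_momentum_jac a b)) => x; rewrite block_mxEur.
- apply: (elementary_eq (elementaryM (elementary_cst _ (-1)) (elementary_momentum_jac b a))) => x.
  by rewrite block_mxEdl [in RHS]mxE [in RHS]mxE !fctE mulN1r.
- by apply: (elementary_eq (elementary_cst _ 0)) => x; rewrite block_mxEdr mxE.
Qed.

Lemma elementary_liouville_field (i : 'I_1) (j : 'I_(k + k)) :
  elementary (fun x => liouville_field x i j).
Proof.
rewrite ord1; case: (split_ordP j) => l ->; last first.
  by apply: (elementary_eq (elementary_cst _ 0)) => x; rewrite row_mxEr mxE.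
apply: (@elementary_eq _ _ (fun x => radial (lsubmx x) 0 l)); last first.
  by move=> x; rewrite row_mxEl.
have [->|l0] := eqVneq l 0.
  by apply: (elementary_eq (elementaryM (elementary_cst _ k%:R) elementary_u0)) => x; rewrite mxE.
by apply: (elementary_eq (elementary_cst _ 1)) => x; rewrite mxE (negbTE l0).
Qed.

Lemma is_derive_weight x (w : 'rV[R]_(k + k)) j :
  is_derive x w (fun x => weight (lsubmx x) j) (weight (lsubmx w) j).
Proof.
rewrite (_ : (fun x => _) =
    \sum_i (weight_mx i j *: (fun x : 'rV[R]_(k + k) => x 0 (lshift k i)))).
  apply: is_derive_eq.
    by apply: is_derive_sum => i; apply: is_deriveZ; exact: is_derive_coord.
  rewrite /weight mxE; apply: eq_bigr => i _; rewrite /GRing.scale/= [lsubmx _ _ _]mxE mulrC //.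
apply/funext => y; rewrite /weight mxE fct_sumE; apply: eq_bigr => i _.
by rewrite [lsubmx y _ _]mxE fctE mulrC.
Qed.

Lemma is_derive_amplitude x (w : 'rV[R]_(k + k)) j :
  is_derive x w (fun x => amplitude (lsubmx x) j) ((j == 0)%:R * lsubmx w 0 0).
Proof.
rewrite /amplitude; case: (j == 0); last first.
  by rewrite mul0r; exact: is_derive_cst.
rewrite (_ : (fun x => _) = (fun x : 'rV[R]_(k + k) => x 0 (lshift k (0 : 'I_k))) + cst (-1)).
  apply: is_derive_eq; first by apply: is_deriveD; exact: is_derive_coord.
  by rewrite mul1r addr0 mxE.
by apply/funext => y; rewrite !mxE.
Qed.

Lemma is_derive_expw x (w : 'rV[R]_(k + k)) j :
  is_derive x w (fun x => expR (weight (lsubmx x) j))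
    (weight (lsubmx w) j * expR (weight (lsubmx x) j)).
Proof.
apply: is_derive_exp; last exact: is_derive_weight.
exact/elementary_differentiable/elementary_weight.
Qed.

Lemma derive_momentum x w j : 'D_w (fun x => momentum x 0 j) x =
  ((j == 0)%:R * lsubmx w 0 0 + amplitude (lsubmx x) j * weight (lsubmx w) j)
   * expR (weight (lsubmx x) j).
Proof.
rewrite (_ : (fun x => _) =
    (fun x => amplitude (lsubmx x) j) * (fun x => expR (weight (lsubmx x) j))).
  have [_ ->] := is_deriveM (is_derive_amplitude x w j) (is_derive_expw x w j).
  by rewrite /GRing.scale/=; ring.
by apply/funext => y; rewrite mxE.
Qed.

Lemma derive_momentum_jac x w i j : 'D_w (fun x => momentum_jac x i j) x =
  ((j == 0)%:R * lsubmx w 0 0 * weight_mx i j +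
   (((i == 0) && (j == 0))%:R + amplitude (lsubmx x) j * weight_mx i j) * weight (lsubmx w) j)
   * expR (weight (lsubmx x) j).
Proof.
rewrite (_ : (fun x => _) =
    (cst ((i == 0) && (j == 0))%:R + weight_mx i j *: (fun x => amplitude (lsubmx x) j))
    * (fun x => expR (weight (lsubmx x) j))).
  have [_ ->] := is_deriveM
    (is_deriveD (is_derive_cst (((i == 0) && (j == 0))%:R : R) x w)
      (is_deriveZ (weight_mx i j) (is_derive_amplitude x w j)))
    (is_derive_expw x w j).
  rewrite -[(_ + _) x]/(((i == 0) && (j == 0))%:R
    + weight_mx i j * amplitude (lsubmx x) j) /GRing.scale/=.
  by ring.
by apply/funext => y; rewrite [LHS]mxE [amplitude _ _ * _]mulrC.
Qed.

Lemma lsubmx_deltal l : lsubmx (delta_mx 0 (lshift k l) : 'rV[R]_(k + k)) = delta_mx 0 l.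
Proof. by apply/rowP => i; rewrite !mxE !eqxx (inj_eq (@lshift_inj _ _)). Qed.
Lemma lsubmx_deltar l : lsubmx (delta_mx 0 (rshift k l) : 'rV[R]_(k + k)) = 0.
Proof. by apply/rowP => i; rewrite !mxE eqxx /= eq_lrshift. Qed.

Lemma weight_delta l j : weight (delta_mx 0 l) j = weight_mx l j.
Proof. by rewrite /weight -rowE mxE. Qed.
Lemma weight0 j : weight 0 j = 0.
Proof. by rewrite /weight mul0mx mxE. Qed.

Lemma derive_momentumE x i j :
  'D_(delta_mx 0 (lshift k i)) (fun x => momentum x 0 j) x = momentum_jac x i j.
Proof.
rewrite derive_momentum lsubmx_deltal weight_delta !mxE eqxx/= [0 == i]eq_sym.
by congr ((_ + _) * _); case: (i == 0); case: (j == 0); rewrite ?mulr1 ?mulr0.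
Qed.
Lemma derive_momentum0 x i j :
  'D_(delta_mx 0 (rshift k i)) (fun x => momentum x 0 j) x = 0.
Proof.
by rewrite derive_momentum lsubmx_deltar weight0 mxE !mulr0 addr0 mul0r.
Qed.
Lemma derive_momentum_jac0 x l i j :
  'D_(delta_mx 0 (rshift k l)) (fun x => momentum_jac x i j) x = 0.
Proof.
by rewrite derive_momentum_jac lsubmx_deltar weight0 mxE !(mulr0,mul0r) addr0 mul0r.
Qed.
(** Symmetry of the second derivatives of the momenta. It gives the
closedness of the symplectic form and, through the Euler identity, the formula
for its Lie derivative. *)
Lemma derive_momentum_jacC x l i j :
  'D_(delta_mx 0 (lshift k l)) (fun x => momentum_jac x i j) x =
  'D_(delta_mx 0 (lshift k i)) (fun x => momentum_jac x l j) x.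
Proof.
rewrite !derive_momentum_jac !lsubmx_deltal !weight_delta; congr (_ * _).
rewrite !(mxE, eqxx)/= ![0 == _]eq_sym.
have [->|j0] := eqVneq j 0; last by rewrite !andbF /= !mul0r; ring.
by case: (i == 0); case: (l == 0); rewrite /=; ring.
Qed.

Lemma weightD u v j : weight (u + v) j = weight u j + weight v j.
Proof. by rewrite /weight mulmxDl mxE. Qed.
Lemma weightN u j : weight (- u) j = - weight u j.
Proof. by rewrite /weight mulNmx mxE. Qed.

Lemma symplectic_form_skew x : (symplectic_form x)^T = - symplectic_form x.
Proof.
by rewrite /symplectic_form tr_block_mx opp_block_mx !trmx0 !oppr0 linearN/= trmxK opprK.
Qed.

(** The momenta other than [P_0] only depend on their own coordinate, so
their Jacobian matrix is triangular. *)
Lemma momentum_jac_unit x : momentum_jac x \in unitmx.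
Proof.
have trig : is_trig_mx (momentum_jac x).
  apply/is_trig_mxP => i j ij; rewrite mxE mxE.
  have j0 : j != 0 by apply/eqP => j0; move: ij; rewrite j0.
  by rewrite (negbTE j0) andbF (ltn_eqF ij : (i == j) = false) mulr0 addr0 mul0r.
rewrite unitmxE det_trig// unitfE; apply/prodf_neq0 => i _.
rewrite mxE mxE; apply: mulf_neq0; last by rewrite gt_eqF// expR_gt0.
rewrite andbb eqxx /amplitude.
by case: (i == 0); rewrite /= ?oppr0 ?mulr0 ?addr0 ?add0r ?mulr1 oner_neq0.
Qed.

Lemma symplectic_form_unit x : symplectic_form x \in unitmx.
Proof.
have Ku := momentum_jac_unit x; set K := momentum_jac x in Ku.
have /mulmx1_unit[] // : symplectic_form x *m block_mx 0 (- (invmx K)^T) (invmx K) 0 = 1%:M.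
rewrite /symplectic_form -/K mulmx_block !mul0mx !mulmx0 !addr0 !add0r mulmxV//.
by rewrite mulNmx mulmxN opprK -trmx_mul mulVmx// trmx1 -scalar_mx_block.
Qed.

Lemma sum_delta0 (F : 'I_k -> R) : \sum_i (i == 0)%:R * F i = F 0.
Proof.
rewrite (bigD1 (ord0 : 'I_k))//= big1 ?addr0 ?mul1r// => i i0.
by rewrite (negbTE i0) mul0r.
Qed.

Lemma radialE u i : radial u 0 i = if i == 0 then k%:R * (u 0 0 - 1) else 1.
Proof. by rewrite mxE. Qed.
Lemma weight_mxE i j : weight_mx i j = if j == 0 then - (i != 0)%:R else (i == j)%:R.
Proof. by rewrite mxE. Qed.

(** The Euler identity [X P_j = P_j]. For [j = 0] the factor [u_0 - 1] has
weight [k] and the exponential has weight [-(k - 1)]. *)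
Lemma radial_momentum_jac x : radial (lsubmx x) *m momentum_jac x = momentum x.
Proof.
apply/rowP => j; rewrite mxE [RHS]mxE.
under eq_bigr do rewrite [momentum_jac _ _ _]mxE mulrA.
rewrite -mulr_suml; congr (_ * _).
rewrite /amplitude; set u0 := lsubmx x 0 0 - 1.
have [->|j0] := eqVneq j 0.
  rewrite big_ord_recl radialE weight_mxE/= -/u0 oppr0 mulr0 addr0 mulr1.
  rewrite (eq_bigr (fun=> - u0)) => [|i _]; last first.
    by rewrite radialE weight_mxE /= mul1r add0r mulrN1.
  by rewrite sumr_const card_ord mulr_natl mulrS mulNrn addrK.
rewrite (bigD1 j)//= big1 => [|i ij]; last first.
  by rewrite weight_mxE (negbTE j0) andbF (negbTE ij) !(mulr0, addr0).
by rewrite radialE weight_mxE (negbTE j0) eqxx add0r addr0 !mulr1.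
Qed.

Lemma contract_liouville :
  Defs.contract liouville_field symplectic_form = liouville_form.
Proof.
apply/funext => x; rewrite /Defs.contract /liouville_field /symplectic_form.
by rewrite mul_row_block !(mulmx0, mul0mx) !addr0 radial_momentum_jac.
Qed.

Section AtHalfSpacePoint.
Variable x : 'rV[R]_(k + k).
Hypothesis hx : half_space x.

Lemma elementary_partialE (f : 'rV[R]_(k + k) -> R) (i : 'I_(k + k)) : elementary f ->
  partial f i x = 'D_(delta_mx 0 i) f x.
Proof. by move=> ef; apply: partialE => //; exact: elementary_differentiable. Qed.

Lemma partial_form_ul (i j : 'I_k) (l : 'I_(k + k)) :
  partial (fun y => symplectic_form y (lshift k i) (lshift k j)) l x = 0.
Proof.
rewrite elementary_partialE; last exact: elementary_symplectic_form.
by under eq_fun do rewrite block_mxEul mxE; rewrite derive_cst.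
Qed.
Lemma partial_form_dr (i j : 'I_k) (l : 'I_(k + k)) :
  partial (fun y => symplectic_form y (rshift k i) (rshift k j)) l x = 0.
Proof.
rewrite elementary_partialE; last exact: elementary_symplectic_form.
by under eq_fun do rewrite block_mxEdr mxE; rewrite derive_cst.
Qed.
Lemma partial_form_ur (i j : 'I_k) (l : 'I_(k + k)) :
  partial (fun y => symplectic_form y (lshift k i) (rshift k j)) l x =
  'D_(delta_mx 0 l) (fun y => momentum_jac y i j) x.
Proof.
rewrite elementary_partialE; last exact: elementary_symplectic_form.
by under eq_fun do rewrite block_mxEur.
Qed.
Lemma partial_form_dl (i j : 'I_k) (l : 'I_(k + k)) :
  partial (fun y => symplectic_form y (rshift k i) (lshift k j)) l x =
  - 'D_(delta_mx 0 l) (fun y => momentum_jac y j i) x.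
Proof.
rewrite elementary_partialE; last exact: elementary_symplectic_form.
have -> : (fun y => symplectic_form y (rshift k i) (lshift k j)) =
          - (fun y => momentum_jac y j i).
  by apply/funext => y; rewrite block_mxEdl mxE [in LHS]mxE.
rewrite deriveN//; apply/diff_derivable/elementary_differentiable.
exact: elementary_momentum_jac.
Qed.

Lemma symplectic_form_closed (a b c : 'I_(k + k)) : d2 symplectic_form x a b c = 0.
Proof.
rewrite /d2; case: (split_ordP a) => i ->; case: (split_ordP b) => j ->;
  case: (split_ordP c) => l ->;
  rewrite ?(partial_form_ul, partial_form_dr, partial_form_ur, partial_form_dl);
  rewrite ?derive_momentum_jac0 ?oppr0 ?addr0 ?add0r //.
- by rewrite (derive_momentum_jacC _ j i) subrr.
- by rewrite (derive_momentum_jacC _ i l) addrC subrr.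
- by rewrite (derive_momentum_jacC _ l j) subrr.
Qed.

Lemma d1_liouville_form : d1 liouville_form x = symplectic_form x.
Proof.
have El (l : 'I_(k + k)) (j : 'I_k) :
    partial (fun y => liouville_form y 0 (lshift k j)) l x = 0.
  rewrite elementary_partialE; last exact: elementary_liouville_form.
  by under eq_fun do rewrite row_mxEl mxE; rewrite derive_cst.
have Er (l : 'I_(k + k)) (j : 'I_k) :
    partial (fun y => liouville_form y 0 (rshift k j)) l x =
    'D_(delta_mx 0 l) (fun y => momentum y 0 j) x.
  rewrite elementary_partialE; last exact: elementary_liouville_form.
  by under eq_fun do rewrite row_mxEr.
apply/matrixP => a b; rewrite mxE.
case: (split_ordP a) => i ->; case: (split_ordP b) => j ->; rewrite ?El ?Er.
- by rewrite block_mxEul mxE subrr.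
- by rewrite block_mxEur derive_momentumE subr0.
- by rewrite block_mxEdl derive_momentumE sub0r [RHS]mxE [in RHS]mxE.
- by rewrite block_mxEdr !derive_momentum0 subrr mxE.
Qed.

Lemma partial_field_l (i : 'I_(k + k)) (j : 'I_k) :
  partial (fun y => liouville_field y 0 (lshift k j)) i x =
  (j == 0)%:R * k%:R * (i == lshift k 0)%:R.
Proof.
rewrite elementary_partialE; last exact: elementary_liouville_field.
have [->|j0] := eqVneq j 0; last first.
  under eq_fun do rewrite row_mxEl mxE (negbTE j0).
  by rewrite derive_cst !mul0r.
rewrite mul1r.
have -> : (fun y : 'rV[R]_(k + k) => liouville_field y 0 (lshift k 0)) =
    k%:R *: (fun y => amplitude (lsubmx y) 0).
  by apply/funext => y; rewrite row_mxEl mxE.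
have [_ ->] := is_deriveZ k%:R (is_derive_amplitude x (delta_mx 0 i) 0).
by rewrite mul1r !mxE /= [_ == i]eq_sym.
Qed.
Lemma partial_field_r (i : 'I_(k + k)) (j : 'I_k) :
  partial (fun y => liouville_field y 0 (rshift k j)) i x = 0.
Proof.
rewrite elementary_partialE; last exact: elementary_liouville_field.
by under eq_fun do rewrite row_mxEr mxE; rewrite derive_cst.
Qed.

(** The Euler identity differentiated along the [i]-th coordinate. *)
Lemma radial_derive_momentum_jac i j :
  \sum_l (radial (lsubmx x) 0 l * 'D_(delta_mx 0 (lshift k l)) (fun y => momentum_jac y i j) x)
   + k%:R * (i == 0)%:R * momentum_jac x 0 j = momentum_jac x i j.
Proof.
under eq_bigr do rewrite derive_momentum_jacC.
rewrite -[RHS]derive_momentumE.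
have -> : (fun y => momentum y 0 j) =
    \sum_l ((fun y => radial (lsubmx y) 0 l) * (fun y => momentum_jac y l j)).
  by apply/funext => y; rewrite -radial_momentum_jac mxE fct_sumE.
have er (l : 'I_k) : is_derive x (delta_mx 0 (lshift k i))
    (fun y : 'rV[R]_(k + k) => radial (lsubmx y) 0 l)
    ((l == 0)%:R * k%:R * (i == 0)%:R).
  have [->|l0] := eqVneq l 0.
    rewrite (_ : (fun y => _) = k%:R *: (fun y => amplitude (lsubmx y) 0)).
      apply: is_derive_eq; first by apply: is_deriveZ; exact: is_derive_amplitude.
      by rewrite !mul1r lsubmx_deltal mxE eqxx/= [0 == i]eq_sym.
    by apply/funext => y; rewrite mxE.
  rewrite (_ : (fun y => _) = cst 1); first by rewrite !mul0r; exact: is_derive_cst.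
  by apply/funext => y; rewrite mxE (negbTE l0).
have ek (l : 'I_k) : is_derive x (delta_mx 0 (lshift k i)) (fun y => momentum_jac y l j)
    ('D_(delta_mx 0 (lshift k i)) (fun y => momentum_jac y l j) x).
  by apply/derivableP/diff_derivable/elementary_differentiable/elementary_momentum_jac.
have [_ ->] := is_derive_sum (fun l => is_deriveM (er l) (ek l)).
rewrite big_split/=; congr (_ + _).
under eq_bigr do rewrite /GRing.scale/= mulrC -!mulrA.
by rewrite sum_delta0 mulrA.
Qed.

Lemma Lie_liouville_field :
  Lie liouville_field symplectic_form x = symplectic_form x.
Proof.
apply/matrixP => a b; rewrite mxE big_split_ord/=.
have Xl l : liouville_field x 0 (lshift k l) = radial (lsubmx x) 0 l by rewrite row_mxEl.
have Xr l : liouville_field x 0 (rshift k l) = 0 by rewrite row_mxEr mxE.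
rewrite [X in _ + X = _]big1 => [|l _]; last first.
  by rewrite Xr !partial_field_r mul0r !mulr0 !addr0.
under eq_bigr do rewrite Xl !partial_field_l.
rewrite addr0; case: (split_ordP a) => i ->; case: (split_ordP b) => j ->.
- under eq_bigr do rewrite !partial_form_ul !block_mxEul !mxE !mul0r mulr0 !addr0.
  by rewrite big1// block_mxEul mxE.
- under eq_bigr do rewrite partial_form_ur block_mxEur block_mxEul eq_rlshift
    (inj_eq (@lshift_inj _ _)) mulr0 mulr0 addr0.
  rewrite block_mxEur -[RHS]radial_derive_momentum_jac big_split/=; congr (_ + _).
  rewrite -[RHS](sum_delta0 (fun l => k%:R * (i == 0)%:R * momentum_jac x l j)).
  by apply: eq_bigr => l _; ring.
- under eq_bigr do rewrite partial_form_dl block_mxEdl eq_rlshift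
    (inj_eq (@lshift_inj _ _)) mulr0 mulr0 addr0 mulrN.
  rewrite block_mxEdl [RHS]mxE [in RHS]mxE -[in RHS]radial_derive_momentum_jac.
  rewrite big_split/= sumrN opprD; congr (_ + _).
  rewrite -[in RHS](sum_delta0 (fun l => k%:R * (j == 0)%:R * momentum_jac x l i)) -sumrN.
  by apply: eq_bigr => l _; rewrite [(- _^T) _ _]mxE [_^T _ _]mxE; ring.
- under eq_bigr do rewrite partial_form_dr !eq_rlshift !mulr0 !addr0.
  by rewrite big1// block_mxEdr mxE.
Qed.

End AtHalfSpacePoint.

Lemma liouville_field_inward x : x 0 (lshift k 0) = 0 ->
  liouville_field x 0 (lshift k 0) < 0.
Proof.
by move=> x0; rewrite row_mxEl !mxE/= x0 sub0r mulrN1 oppr_lt0 ltr0n.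
Qed.

(** The affine map [x |-> x M + c] preserves the symplectic form and the
Liouville field; tangent vectors are rows, so its differential acts by [M] on
the right. *)
Definition liouville_symmetry (M : 'M[R]_(k + k)) (c : 'rV[R]_(k + k)) :=
  (forall x, symplectic_form x = M *m symplectic_form (x *m M + c) *m M^T) /\
  (forall x, liouville_field (x *m M + c) = liouville_field x *m M).

Lemma liouville_symmetry_comp M c M' c' :
  liouville_symmetry M c -> liouville_symmetry M' c' ->
  liouville_symmetry (M *m M') (c *m M' + c').
Proof.
move=> [Mw Mx] [Mw' Mx']; have E x : x *m (M *m M') + (c *m M' + c') = (x *m M + c) *m M' + c'.
  by rewrite mulmxDl mulmxA addrA.
split=> x; rewrite E.
  by rewrite {1}Mw {1}Mw' trmx_mul !mulmxA.
by rewrite Mx' Mx mulmxA.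
Qed.

Lemma liouville_symmetry_block (A B : 'M[R]_k) (a b : 'rV[R]_k) :
  (forall x, momentum_jac x = A *m momentum_jac (x *m block_mx A 0 0 B + row_mx a b) *m B^T) ->
  (forall u, radial (u *m A + a) = radial u *m A) ->
  liouville_symmetry (block_mx A 0 0 B) (row_mx a b).
Proof.
move=> KE XE; split=> x.
  rewrite /symplectic_form {1 2}KE; set K := momentum_jac (_ + _).
  rewrite tr_block_mx !trmx0 !mulmx_block !(mul0mx, mulmx0, addr0, add0r).
  by rewrite !trmx_mul trmxK !(mulmxN, mulNmx) mulmxA.
rewrite /liouville_field mul_row_block !(mul0mx, mulmx0, addr0) -XE.
congr (row_mx (radial _) _).
by rewrite -{1}[x]hsubmxK mul_row_block !mulmx0 addr0 add0r add_row_mx row_mxKl.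
Qed.

Lemma lsubmx_block (A B : 'M[R]_k) (a b : 'rV[R]_k) x :
  lsubmx (x *m block_mx A 0 0 B + row_mx a b) = lsubmx x *m A + a.
Proof. by rewrite -{1}[x]hsubmxK mul_row_block !mulmx0 addr0 add0r add_row_mx row_mxKl. Qed.
Lemma rsubmx_block (A B : 'M[R]_k) (a b : 'rV[R]_k) x :
  rsubmx (x *m block_mx A 0 0 B + row_mx a b) = rsubmx x *m B + b.
Proof. by rewrite -{1}[x]hsubmxK mul_row_block !mulmx0 addr0 add0r add_row_mx row_mxKr. Qed.

Definition dilation a : 'M[R]_k := diag_mx (\row_j expR (- weight a j)).

(** Translations of the coordinates [u_j], [j > 0], rescale each momentum,
and the dilation of the dual coordinates compensates for it. *)
Lemma deck_symmetry (a b : 'rV[R]_k) : a 0 0 = 0 ->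
  liouville_symmetry (block_mx 1%:M 0 0 (dilation a)) (row_mx a b).
Proof.
move=> a0; apply: liouville_symmetry_block => [x|u].
  apply/matrixP => i j; rewrite mul1mx /dilation tr_diag_mx mul_mx_diag [RHS]mxE.
  rewrite ![momentum_jac _ _ _]mxE lsubmx_block mulmx1 weightD expRD.
  rewrite -!mulrA [(\row_j _) _ _]mxE -[expR (weight a j) * _]expRD subrr expR0 mulr1.
  by rewrite /amplitude [(_ + a) _ _]mxE a0 addr0.
by apply/rowP => i; rewrite !mulmx1 !mxE a0 addr0.
Qed.

(** Linear part of the involution that exchanges the two ends of the strip.
It acts by the same diagonal matrix on [u] and on [y]: as [P_0] is odd in
[u_0 - 1], the sign of [y_0] has to change together with that of [u_0 - 1]. *)
Definition flip_mx : 'M[R]_k := diag_mx (\row_j (if j == 0 then -1 else 1)).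
Definition flip_shift : 'rV[R]_k := \row_j (if j == 0 then 2 else 0).

Lemma flip_symmetry :
  liouville_symmetry (block_mx flip_mx 0 0 flip_mx) (row_mx flip_shift 0).
Proof.
have fu u j : (u *m flip_mx + flip_shift) 0 j = if j == 0 then 2 - u 0 0 else u 0 j.
  rewrite mxE /flip_mx mul_mx_diag !mxE; have [->|_] := eqVneq j 0; first by ring.
  by rewrite mulr1 addr0.
apply: liouville_symmetry_block => [x|u].
  apply/matrixP => i j; rewrite /flip_mx tr_diag_mx mul_mx_diag mul_diag_mx [RHS]mxE [in RHS]mxE.
  rewrite ![momentum_jac _ _ _]mxE lsubmx_block -/flip_mx.
  have -> : weight (lsubmx x *m flip_mx + flip_shift) j = weight (lsubmx x) j.
    rewrite /weight !mxE; apply: eq_bigr => l _; rewrite fu.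
    have [->|//] := eqVneq l 0; rewrite !mxE eqxx oppr0.
    by have [_|j0] := eqVneq j 0; rewrite ?mulr0// [0 == j]eq_sym (negbTE j0) !mulr0.
  rewrite !mxE /amplitude fu eqxx.
  case: (eqVneq j 0) => [_|j0]; case: (eqVneq i 0) => [i0|_] /=; try by ring.
  by rewrite i0 [0 == j]eq_sym (negbTE j0) /= !(mulr0n, mulr0, addr0, mul0r).
apply/rowP => j.
have -> : (radial u *m flip_mx) 0 j = radial u 0 j * (if j == 0 then -1 else 1).
  by rewrite /flip_mx mul_mx_diag !mxE.
by rewrite !radialE fu eqxx; case: (j == 0); ring.
Qed.

End Liouville.

(** * A totally real polynomial with explicit units *)

Section Roots.
Variables (R : realType) (k : nat).
Implicit Types (i j : 'I_k).

Definition node i : int := (3 * i)%:Z.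
Definition node_poly : {poly int} := \prod_i ('X - (node i)%:P).
(** Modulo this polynomial the factors of [node_poly] have product 1, so
that each of them is a unit. The nodes are spread out for the roots to be
real and close to them. *)
Definition unit_poly : {poly int} := node_poly - 1.

Lemma node_dist i j : i != j -> 3 <= `|(node i)%:~R - (node j)%:~R| :> R.
Proof.
move=> ij; rewrite -intrB -intr_norm (_ : 3 = 3%:~R)// ler_int.
have : (i != j :> nat) by [].
rewrite /node; lia.
Qed.

Definition partial_prod j (x : R) : R := \prod_(i | i != j) (x - (node i)%:~R).

Lemma partial_prod_ge1 j (e : R) : `|e| = 1 -> 1 <= `|partial_prod j ((node j)%:~R + e)|.
Proof.
move=> e1; rewrite normr_prod.
elim/big_ind: _ => // [x y x1 y1|i ij]; first by rewrite -[1]mulr1 ler_pM.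
have := node_dist ij; rewrite distrC => d.
have := ler_distD e ((node j)%:~R + e) (node i)%:~R.
have : `|(node j)%:~R - (node i)%:~R| <= `|(node j)%:~R + e - (node i)%:~R| + `|e| :> R.
  apply: le_trans (ler_normB _ _); rewrite le_eqVlt; apply/orP; left; apply/eqP.
  by congr (`|_|); ring.
rewrite e1 => h _; lra.
Qed.

(** Between the two neighbours at distance 1 of a node, only the factor of
that node changes sign. *)
Lemma partial_prod_sign j :
  0 < partial_prod j ((node j)%:~R + 1) * partial_prod j ((node j)%:~R - 1).
Proof.
rewrite -big_split/=; apply: prodr_gt0 => i ij.
have := node_dist ij; set d : R := _ - _ => d3.
have -> : ((node j)%:~R + 1 - (node i)%:~R) * ((node j)%:~R - 1 - (node i)%:~R) = `|d| ^+ 2 - 1 :> R.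
  by rewrite real_normK ?num_real// /d; ring.
nra.
Qed.

Definition node_val (x : R) : R := \prod_i (x - (node i)%:~R).

Lemma node_valE x : node_val x = (map_poly intr node_poly).[x].
Proof.
rewrite /node_poly rmorph_prod/= horner_prod; apply: eq_bigr => i _.
by rewrite rmorphB/= map_polyX map_polyC/= !hornerE.
Qed.

Lemma unit_polyE x : (map_poly intr unit_poly).[x] = node_val x - 1 :> R.
Proof. by rewrite /unit_poly rmorphB rmorph1 hornerD hornerN hornerC node_valE. Qed.

Lemma node_val_partial j x : node_val x = (x - (node j)%:~R) * partial_prod j x.
Proof. by rewrite /node_val (bigD1 j). Qed.

(** By the previous two lemmas [node_val] is at least 1 at one of the two
points at distance 1 from the node, and it vanishes at the node; the
intermediate value theorem applies on the segment between them. *)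
Lemma exists_root j :
  exists x : R, node_val x = 1 /\ `|x - (node j)%:~R| <= 1.
Proof.
set n : R := (node j)%:~R.
have n0 : node_val n = 0 by rewrite (node_val_partial j) subrr mul0r.
have [h1|h1] := lerP 0 (partial_prod j (n + 1)).
  have g1 : 1 <= node_val (n + 1).
    rewrite (node_val_partial j) addrAC subrr add0r mul1r -[leRHS]ger0_norm//.
    by apply: partial_prod_ge1; rewrite normr1.
  have [||x /andP[x0 x1]] := @poly_ivt R (map_poly intr unit_poly) n (n + 1).
  - by rewrite lerDl.
  - by rewrite !unit_polyE n0; apply/andP; split; lra.
  rewrite rootE unit_polyE subr_eq0 => /eqP E; exists x; split=> //.
  by rewrite ger0_norm; lra.
have h2 : partial_prod j (n - 1) < 0.
  by have := partial_prod_sign j; rewrite -/n; nra.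
have g1 : 1 <= node_val (n - 1).
  rewrite (node_val_partial j) addrAC subrr add0r mulN1r -[leRHS]ger0_norm ?normrN; last by lra.
  by apply: partial_prod_ge1; rewrite normrN1.
have [||x /andP[x0 x1]] := @poly_ivt R (- map_poly intr unit_poly) (n - 1) n.
- by rewrite lerBlDr lerDl.
- by rewrite !hornerN !unit_polyE n0; apply/andP; split; lra.
rewrite rootE hornerN oppr_eq0 unit_polyE subr_eq0 => /eqP E; exists x; split=> //.
by rewrite ler0_norm; lra.
Qed.

Definition conj_root j : R := sval (cid (exists_root j)).
Lemma conj_root_val j : node_val (conj_root j) = 1.
Proof. by rewrite /conj_root; case: cid => x []. Qed.
Lemma conj_root_near j : `|conj_root j - (node j)%:~R| <= 1.
Proof. by rewrite /conj_root; case: cid => x []. Qed.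

Lemma conj_root_far i j : i != j -> 2 <= `|conj_root j - (node i)%:~R|.
Proof.
move=> ij; have d := node_dist ij; have r := conj_root_near j.
have := ler_distD (conj_root j) (node i)%:~R (node j)%:~R.
by rewrite [`|_ - conj_root j|]distrC; lra.
Qed.

Lemma conj_root_inj : injective conj_root.
Proof.
move=> i j E; apply/eqP/negPn/negP => ij.
by have := conj_root_far ij; rewrite -E; have := conj_root_near i; lra.
Qed.

Lemma size_node_poly : size node_poly = k.+1.
Proof. by rewrite size_prod_XsubC /index_enum -enumT -cardE card_ord. Qed.

Hypothesis k_gt0 : (0 < k)%N.

Lemma size_unit_poly : size unit_poly = k.+1.
Proof. by rewrite size_polyDl size_node_poly// size_polyN size_poly1. Qed.
Lemma unit_poly_monic : unit_poly \is monic.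
Proof.
rewrite monicE lead_coefDl ?size_polyN ?size_poly1 ?size_node_poly//.
by rewrite -monicE monic_prod_XsubC.
Qed.

(** The [k] roots found are distinct, hence they are all the roots. *)
Lemma prod_conj_root x : \prod_j (x - conj_root j) = node_val x - 1.
Proof.
rewrite -unit_polyE.
have := @all_roots_prod_XsubC R (map_poly intr unit_poly) [seq conj_root j | j <- enum 'I_k].
have mon : (map_poly intr unit_poly : {poly R}) \is monic.
  by rewrite monic_map// unit_poly_monic.
rewrite (monicP mon) scale1r => ->.
- by rewrite big_map horner_prod big_enum/=; apply: eq_bigr => j _; rewrite !hornerE.
- rewrite size_map size_enum_ord size_map_inj_poly//; first exact: size_unit_poly.
  exact: intr_inj.
- by apply/allP => _ /mapP[j _ ->]; rewrite rootE unit_polyE conj_root_val subrr.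
- by rewrite uniq_rootsE map_inj_uniq ?enum_uniq//; exact: conj_root_inj.
Qed.

(** At a node the product of the factors [x - r_j] is -1, so every unit has
norm 1 or -1. *)
Lemma norm_unit i : \prod_j (conj_root j - (node i)%:~R) ^+ 2 = 1.
Proof.
under eq_bigr do rewrite -sqrrN opprB.
by rewrite prodrXl prod_conj_root (node_val_partial i) subrr mul0r sub0r sqrrN expr1n.
Qed.

End Roots.

(** * Discrete subsets and lattices *)

Section Discrete.
Variable R : realType.

Lemma int_near_eq (r : R) : \forall x \near r, x \is a Num.int -> x = r.
Proof.
have [rint|rnint] := boolP (r \is a Num.int).
  apply/nbhs_ballP; exists 1 => //= x; rewrite /ball/= => rx xint.
  have /intrP[n En] : r - x \is a Num.int by rewrite rpredB.
  move: rx; rewrite En -intr_norm -[ltRHS]/(1%:~R) ltr_int => n1.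
  have n0 : n = 0 by lia.
  by apply/esym/eqP; rewrite -subr_eq0 En n0.
have fr : (Num.floor r)%:~R < r.
  rewrite lt_neqAle floor_le_tmp andbT; apply: contra rnint => /eqP <-; exact: intr_int.
have rf : r < (Num.floor r + 1)%:~R by exact: floorD1_gt.
have : \forall x \near r, x \in `](Num.floor r)%:~R, (Num.floor r + 1)%:~R[.
  by apply: near_in_itvoo; rewrite in_itv/= fr.
apply: filterS => x; rewrite in_itv/= => /andP[+ +] /intrP[n En].
by rewrite En !ltr_int => ? ?; lia.
Qed.

Definition integral_row k (z : 'rV[R]_k) := forall i, z 0 i \is a Num.int.

Lemma integral_row_near k (p : 'rV[R]_k) :
  \forall z \near p, integral_row z -> z = p.
Proof.
have : \forall z \near p, forall i : 'I_k, (z : 'rV[R]_k) 0 i \is a Num.int -> z 0 i = p 0 i.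
  apply: (@filter_forall _ _ (fun (i : 'I_k) (z : 'rV[R]_k) =>
    z 0 i \is a Num.int -> z 0 i = p 0 i) (nbhs p)) => i.
  exact: (@coord_continuous R 1 k 0 i p _ (int_near_eq _)).
by apply: filterS => z H zi; apply/rowP => i; exact: H.
Qed.

Lemma affine_continuous p q (M : 'M[R]_(p, q)) (c : 'rV[R]_q) :
  continuous (fun x : 'rV[R]_p => x *m M + c).
Proof. by apply: elementary_continuous => i j; exact: elementary_affine. Qed.

Lemma mulmx_continuous p q (M : 'M[R]_(p, q)) :
  continuous (fun x : 'rV[R]_p => x *m M).
Proof.
by have := @affine_continuous _ _ M 0; under eq_fun do rewrite addr0.
Qed.

(** For a subset of a Hausdorff space this amounts to being closed and
discrete, and it is stable under inclusion and under preimage by an injective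
continuous map. *)
Definition closed_discrete (T : topologicalType) (A : set T) :=
  forall p, \forall x \near p, A x -> x = p.

(** In the coordinates given by the basis, a lattice consists of integral
points. *)
Lemma lattice_closed_discrete k (B : 'M[R]_k) : B \in unitmx ->
  closed_discrete [set y | exists2 z : 'rV[R]_k, integral_row z & y = z *m B].
Proof.
move=> Bu p.
have H : \forall y \near p, integral_row (y *m invmx B) ->
    y *m invmx B = p *m invmx B.
  exact: (mulmx_continuous (integral_row_near (p *m invmx B))).
apply: filterS H => y H [z zi yE].
have e : y *m invmx B = z by rewrite yE mulmxK.
by move: H; rewrite e => /(_ zi) zE; rewrite yE zE mulmxKV.
Qed.

Lemma floor_lattice k (z : 'rV[R]_k) : exists2 n : 'rV[R]_k,
  integral_row n & forall i, 0 <= (z - n) 0 i <= 1.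
Proof.
exists (\row_i (Num.floor (z 0 i))%:~R) => [i|i]; first by rewrite mxE intr_int.
rewrite !mxE subr_ge0 floor_le_tmp/= lerBlDl -[X in _ + X]/(1%:~R) -intrD ltW//.
exact: floorD1_gt.
Qed.

(** If [v B = 0], the equation of a column [j] for which [|v_j|] is maximal
forces [v_j = 0]. *)
Lemma col_dominant_unit k (B : 'M[R]_k) :
  (forall j, \sum_(i | i != j) `|B i j| < `|B j j|) -> B \in unitmx.
Proof.
case: k B => [|k] B dom; first by rewrite unitmxE det_mx00 unitr1.
rewrite -row_free_unit -kermx_eq0; apply/eqP/row_matrixP => i0.
rewrite row0; set v := row _ _.
have vB : v *m B = 0 by apply/sub_kermxP; exact: row_sub.
apply/eqP/negPn/negP => v0.
(* the index of an entry of maximal modulus *)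
pose j := [arg max_(j > ord0) `|v 0 j|]%O.
have jmax l : `|v 0 l| <= `|v 0 j|.
  by rewrite /j; case: arg_maxP => // i _ H; exact: H.
have vj : 0 < `|v 0 j|.
  rewrite normr_gt0; apply: contra v0 => /eqP vj0; apply/eqP/rowP => l.
  by rewrite [RHS]mxE; apply/eqP; rewrite -normr_le0 (le_trans (jmax l))// vj0 normr0.
have := dom j; rewrite -(ltr_pM2l vj) ltNge => /negP; apply.
have /rowP/(_ j) := vB; rewrite mxE [RHS]mxE (bigD1 j)//= => /eqP.
rewrite addr_eq0 => /eqP E; rewrite -normrM E normrN.
apply: le_trans (ler_norm_sum _ _ _) _; rewrite mulr_sumr; apply: ler_sum => l _.
by rewrite normrM ler_wpM2r.
Qed.

End Discrete.

(** * The two lattices defined by the units *)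

Section Lattices.
Variables (R : realType) (k' : nat).
Notation k := k'.+1.
Implicit Types (a b y u : 'rV[R]_k) (i j : 'I_k).
Notation root := (@conj_root R k).

(** The real embeddings of the ring [Z[x]/(f)], where [f] is
[unit_poly], composed with the projection from [Z[x]]. *)
Definition embedding (Q : {poly int}) : 'rV[R]_k := \row_j (map_poly intr Q).[root j].

Definition fiber_lattice : set 'rV[R]_k := range embedding.

Definition exp_weight a : 'rV[R]_k := \row_j expR (weight a j).

(** The translations whose scaling factors are the conjugates of a unit of
the ring. Asking for both a translation and its opposite makes this a group
and makes the fiber lattice stable under the dilations. *)
Definition base_lattice : set 'rV[R]_k := [set a : 'rV[R]_k |
  [/\ a 0 0 = 0, fiber_lattice (exp_weight a) & fiber_lattice (exp_weight (- a))]].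

Lemma embeddingD P Q : embedding (P + Q) = embedding P + embedding Q.
Proof. by apply/rowP => j; rewrite !mxE rmorphD hornerD. Qed.
Lemma embeddingN P : embedding (- P) = - embedding P.
Proof. by apply/rowP => j; rewrite !mxE rmorphN hornerN. Qed.
Lemma embedding0 : embedding 0 = 0.
Proof. by apply/rowP => j; rewrite !mxE rmorph0 horner0. Qed.
Lemma embeddingM P Q : embedding (P * Q) = \row_j (embedding P 0 j * embedding Q 0 j).
Proof. by apply/rowP => j; rewrite !mxE rmorphM hornerM. Qed.

Lemma fiber_lattice0 : fiber_lattice 0.
Proof. by exists 0 => //; rewrite embedding0. Qed.
Lemma fiber_latticeD a b : fiber_lattice a -> fiber_lattice b -> fiber_lattice (a + b).
Proof. by move=> [P _ <-] [Q _ <-]; exists (P + Q) => //; rewrite embeddingD. Qed.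
Lemma fiber_latticeN a : fiber_lattice a -> fiber_lattice (- a).
Proof. by move=> [P _ <-]; exists (- P) => //; rewrite embeddingN. Qed.
Lemma fiber_latticeM a b : fiber_lattice a -> fiber_lattice b ->
  fiber_lattice (\row_j (a 0 j * b 0 j)).
Proof. by move=> [P _ <-] [Q _ <-]; exists (P * Q) => //; rewrite embeddingM. Qed.

Lemma exp_weight0 : exp_weight 0 = const_mx 1.
Proof. by apply/rowP => j; rewrite !mxE weight0 expR0. Qed.
Lemma exp_weightD a b : exp_weight (a + b) = \row_j (exp_weight a 0 j * exp_weight b 0 j).
Proof. by apply/rowP => j; rewrite !mxE weightD expRD. Qed.

Lemma base_lattice0 : base_lattice 0.
Proof.
have l1 : fiber_lattice (const_mx 1).
  by exists 1 => //; apply/rowP => j; rewrite !mxE rmorph1 hornerC.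
by split; rewrite ?oppr0 ?exp_weight0 ?mxE.
Qed.
Lemma base_latticeN a : base_lattice a -> base_lattice (- a).
Proof. by move=> [a0 p n]; split; rewrite ?opprK// mxE a0 oppr0. Qed.
Lemma base_latticeD a b : base_lattice a -> base_lattice b -> base_lattice (a + b).
Proof.
move=> [a0 p n] [b0 p' n']; split; rewrite ?opprD ?exp_weightD ?mxE ?a0 ?b0 ?addr0//;
exact: fiber_latticeM.
Qed.

Lemma fiber_lattice_dilation a y : base_lattice a -> fiber_lattice y ->
  fiber_lattice (y *m dilation a).
Proof.
move=> [_ _ n] yl; rewrite (_ : _ *m _ = \row_j (y 0 j * exp_weight (- a) 0 j)).
  exact: fiber_latticeM.
by apply/rowP => j; rewrite mul_mx_diag !mxE weightN.
Qed.

Definition vandermonde : 'M[R]_k := Vandermonde k (\row_j root j).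

Lemma vandermonde_unit : vandermonde \in unitmx.
Proof.
rewrite unitmxE det_Vandermonde unitfE; apply/prodf_neq0 => i _.
apply/prodf_neq0 => j ij; rewrite !mxE subr_eq0.
by apply: contraTneq ij => /conj_root_inj ->; rewrite ltnn.
Qed.

(** Euclidean division by the monic polynomial [unit_poly], which vanishes
at the roots, leaves the polynomials of degree less than [k], and their values
are integral combinations of the rows of the Vandermonde matrix. *)
Lemma fiber_latticeE : fiber_lattice =
  [set y | exists2 z : 'rV[R]_k, integral_row z & y = z *m vandermonde].
Proof.
apply/seteqP; split=> y.
  (* The remainder has the same values at the roots. *)
  move=> [Q _ <-]; pose S := Pdiv.CommonRing.rmodp Q (unit_poly k).
  have sS : (size S <= k)%N.
    by rewrite -ltnS -(@size_unit_poly k)// Pdiv.Ring.ltn_rmodpN0// monic_neq0// unit_poly_monic.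
  exists (\row_i (S`_i)%:~R) => [i|]; first by rewrite mxE intr_int.
  apply/rowP => j; rewrite !mxE.
  rewrite {1}(Pdiv.RingMonic.rdivp_eq (@unit_poly_monic k (ltn0Sn _)) Q) -/S.
  rewrite rmorphD rmorphM hornerD hornerM unit_polyE conj_root_val subrr mulr0 add0r.
  rewrite (@horner_coef_wide _ k); last by rewrite (leq_trans (size_poly _ _)).
  by apply: eq_bigr => i _; rewrite coef_map !mxE.
move=> [z zi ->]; exists (\poly_(i < k) Num.floor (z 0 (inord i))) => //.
apply/rowP => j; rewrite !mxE (@horner_coef_wide _ k); last first.
  by rewrite (leq_trans (size_poly _ _))// size_poly.
apply: eq_bigr => i _; rewrite coef_map coef_poly ltn_ord inord_val !mxE.
by congr (_ * _); exact: floorK.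
Qed.

Lemma fiber_lattice_discrete : closed_discrete fiber_lattice.
Proof. rewrite fiber_latticeE; exact/lattice_closed_discrete/vandermonde_unit. Qed.

Lemma fiber_lattice_cocompact y : exists2 b, fiber_lattice b &
  exists2 q : 'rV[R]_k, (forall i, 0 <= q 0 i <= 1) & y = q *m vandermonde + b.
Proof.
have [n ni H] := floor_lattice (y *m invmx vandermonde).
exists (n *m vandermonde); first by rewrite fiber_latticeE; exists n.
exists (y *m invmx vandermonde - n) => //.
by rewrite mulmxBl subrK mulmxKV// vandermonde_unit.
Qed.

Lemma exp_weight_inj a b : a 0 0 = b 0 0 -> exp_weight a = exp_weight b -> a = b.
Proof.
move=> ab /rowP E; apply/rowP => j; have [->//|j0] := eqVneq j 0.
have wE u : weight u j = u 0 j.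
  rewrite /weight mxE (bigD1 j)//= big1 => [|i ij]; rewrite weight_mxE (negbTE j0).
    by rewrite eqxx mulr1 addr0.
  by rewrite (negbTE ij) mulr0.
by have := E j; rewrite !mxE => /expR_inj; rewrite !wE.
Qed.

Lemma exp_weight_continuous : continuous exp_weight.
Proof.
apply: elementary_continuous => i j; rewrite ord1.
have e := elementary_exp (@elementary_affine R k k (weight_mx R k') 0 0 j).
by apply: (elementary_eq e) => y; rewrite /exp_weight mxE /weight /= addr0.
Qed.

(** A translation is determined by its scaling factors, and these belong
to a discrete set. *)
Lemma base_lattice_discrete : closed_discrete base_lattice.
Proof.
move=> p.
have H1 : \forall a \near p, fiber_lattice (exp_weight a) -> exp_weight a = exp_weight p.
  exact: (exp_weight_continuous (@fiber_lattice_discrete _)).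
have H2 : \forall a \near p, (a : 'rV[R]_k) 0 0 \is a Num.int -> a 0 0 = p 0 0.
  exact: (@coord_continuous R 1 k 0 0 p _ (int_near_eq _)).
apply: filterS2 H1 H2 => a H1 H2 [a0 al _].
by apply: exp_weight_inj; [apply: H2; rewrite a0 | exact: H1].
Qed.

(** Row [i > 0] is the translation attached to the square of the [i]-th unit.
Row 0, the first basis vector, completes these rows to a basis of the whole
space: the coordinate [u_0] is left alone by the group. *)
Definition log_unit_mx : 'M[R]_k := \matrix_(i, j)
  if i == 0 then (j == 0)%:R else if j == 0 then 0
  else ln ((root j - (node i)%:~R) ^+ 2).

Lemma node_unit_neq0 i j : root j - (node i)%:~R != 0.
Proof.
apply/eqP => E; have := conj_root_val R j; rewrite (node_val_partial i) E mul0r => /eqP.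
by rewrite eq_sym oner_eq0.
Qed.
Lemma node_unit_sqr_gt0 i j : 0 < (root j - (node i)%:~R) ^+ 2.
Proof. by rewrite exprn_even_gt0//= node_unit_neq0. Qed.

Lemma log_unit_gt0 i j : i != j -> 0 < ln ((root j - (node i)%:~R) ^+ 2).
Proof.
move=> ij; apply: ln_gt0; have := @conj_root_far R k i j ij.
by rewrite -real_normK ?num_real//; nra.
Qed.

Lemma sum_log_unit j : \sum_(i < k) ln ((root j - (node i)%:~R) ^+ 2) = 0.
Proof.
apply: expR_inj; rewrite expR_sum expR0.
under eq_bigr do rewrite lnK ?posrE ?node_unit_sqr_gt0//.
by rewrite prodrXl -[X in X ^+ _]/(@node_val R k (root j)) conj_root_val expr1n.
Qed.

(** For a fixed root the logarithms of all the units sum to 0, and only the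
one of the nearest node is negative. Dropping the positive logarithm of unit 0
makes the dominance strict. *)
Lemma log_unit_mx_unit : log_unit_mx \in unitmx.
Proof.
apply: col_dominant_unit => j; have [->|j0] := eqVneq j 0.
  rewrite big1 => [|i i0]; last by rewrite mxE (negbTE i0) eqxx normr0.
  by rewrite mxE eqxx normr1.
have := sum_log_unit j; rewrite (bigD1 j)//= => /eqP; rewrite addr_eq0 => /eqP Ej.
rewrite [X in _ < `|X|]mxE (negbTE j0) Ej normrN ger0_norm; last first.
  by apply: sumr_ge0 => i ij; exact/ltW/log_unit_gt0.
have zj : (0 : 'I_k) != j by rewrite eq_sym.
rewrite (bigD1 (0 : 'I_k) zj)/= [ltRHS](bigD1 (0 : 'I_k) zj)/=.
rewrite mxE eqxx (negbTE j0) normr0 add0r ltr_pwDl//; first by rewrite log_unit_gt0.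
apply: ler_sum => i /andP[ij i0]; rewrite mxE (negbTE i0) (negbTE j0) ger0_norm//.
exact/ltW/log_unit_gt0.
Qed.

Lemma unit_in_lattice i : fiber_lattice (\row_j (root j - (node i)%:~R) ^+ 2).
Proof.
exists (('X - (node i)%:P) ^+ 2) => //; apply/rowP => j.
by rewrite !mxE rmorphXn rmorphB/= map_polyX map_polyC/= !hornerE.
Qed.
(** The inverse of a unit is the product of the other ones. *)
Lemma unit_inv_in_lattice i : fiber_lattice (\row_j (root j - (node i)%:~R) ^- 2).
Proof.
exists ((\prod_(l | l != i) ('X - (node l)%:P)) ^+ 2) => //; apply/rowP => j.
rewrite !mxE rmorphXn rmorph_prod/= horner_exp horner_prod.
rewrite (eq_bigr (fun l => root j - (node l)%:~R)) => [|l _]; last first.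
  by rewrite rmorphB/= map_polyX map_polyC/= !hornerE.
have := conj_root_val R j; rewrite (node_val_partial i) /partial_prod => E.
rewrite -exprVn; congr (_ ^+ _).
by apply: (mulfI (node_unit_neq0 i j)); rewrite E mulfV ?node_unit_neq0.
Qed.

(** The scaling factor at the root 0 is not prescribed by the row: it is the
inverse of the product of the others, and equals the conjugate of the unit
because the norm is 1. *)
Lemma exp_weight_log_unit i : i != 0 ->
  exp_weight (row i log_unit_mx) = \row_j (root j - (node i)%:~R) ^+ 2.
Proof.
move=> i0; apply/rowP => j; rewrite !mxE.
have entry l : (row i log_unit_mx) 0 l =
    if l == 0 then 0 else ln ((root l - (node i)%:~R) ^+ 2).
  by rewrite !mxE (negbTE i0).
have -> : weight (row i log_unit_mx) j = ln ((root j - (node i)%:~R) ^+ 2).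
  rewrite /weight mxE; have [->|j0] := eqVneq j 0; last first.
    rewrite (bigD1 j)//= big1 => [|l lj]; rewrite weight_mxE (negbTE j0).
      by rewrite eqxx mulr1 addr0 entry (negbTE j0).
    by rewrite (negbTE lj) mulr0.
  have : \sum_j ln ((root j - (node i)%:~R) ^+ 2) = 0.
    apply: expR_inj; rewrite expR_sum expR0.
    under eq_bigr do rewrite lnK ?posrE ?node_unit_sqr_gt0//.
    exact: norm_unit.
  rewrite (bigD1 (0 : 'I_k))//= => /eqP; rewrite addr_eq0 => /eqP ->.
  rewrite (bigD1 (0 : 'I_k))//= entry mul0r add0r -sumrN; apply: eq_bigr => l l0.
  by rewrite entry (negbTE l0) weight_mxE eqxx l0 mulrN1.
by rewrite lnK ?posrE ?node_unit_sqr_gt0.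
Qed.

Lemma log_unit_base_lattice i : i != 0 -> base_lattice (row i log_unit_mx).
Proof.
move=> i0; split; first by rewrite !mxE (negbTE i0).
  by rewrite exp_weight_log_unit//; exact: unit_in_lattice.
rewrite (_ : exp_weight _ = \row_j (root j - (node i)%:~R) ^- 2); last first.
  have /rowP E := exp_weight_log_unit i0; apply/rowP => j; move: (E j).
  by rewrite !mxE weightN expRN => ->.
exact: unit_inv_in_lattice.
Qed.

Lemma base_lattice_mulz a (z : int) : base_lattice a -> base_lattice (z%:~R *: a).
Proof.
move=> al; have nat_mul (n : nat) : base_lattice (n%:R *: a).
  elim: n => [|n IH]; first by rewrite scale0r; exact: base_lattice0.
  by rewrite -natr1 scalerDl scale1r; exact: base_latticeD.
case: z => n; first exact: nat_mul.
by rewrite NegzE mulrNz scaleNr; apply/base_latticeN/nat_mul.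
Qed.

(** Only the coordinates of positive index in the basis [log_unit_mx] are
reduced modulo the integers; that of index 0 is [u_0]. *)
Lemma base_lattice_cocompact u : 0 <= u 0 0 <= 2 -> exists2 a, base_lattice a &
  exists2 z : 'rV[R]_k, (forall i, 0 <= z 0 i <= 2) & u = z *m log_unit_mx + a.
Proof.
move=> u02; have [w wB] : exists w : 'rV[R]_k, w *m log_unit_mx = u.
  by exists (u *m invmx log_unit_mx); rewrite mulmxKV// log_unit_mx_unit.
have w0 : w 0 0 = u 0 0.
  rewrite -wB [RHS]mxE (bigD1 (0 : 'I_k))//= big1 => [|i i0];
    rewrite [log_unit_mx _ _]mxE ?eqxx ?mulr1 ?addr0//.
  by rewrite (negbTE i0) mulr0.
have [n ni nw] := floor_lattice w.
pose n' : 'rV[R]_k := \row_i (if i == 0 then 0 else n 0 i).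
exists (n' *m log_unit_mx).
  rewrite mulmx_sum_row; apply: big_ind => [||i _].
  - exact: base_lattice0.
  - exact: base_latticeD.
  rewrite mxE; have [->|i0] := eqVneq i 0; first by rewrite scale0r; exact: base_lattice0.
  have /intrP[z ->] := ni i.
  exact/base_lattice_mulz/log_unit_base_lattice.
exists (w - n') => [i|]; last by rewrite mulmxBl subrK.
have := nw i; rewrite !mxE; have [->|_] := eqVneq i 0; first by rewrite subr0 w0.
by move=> /andP[-> /le_trans]; apply; rewrite ler1n.
Qed.

End Lattices.

(** * The deck transformations *)

Section Deck.
Variables (R : realType) (k' : nat).
Notation k := k'.+1.
Notation V := 'rV[R]_(k + k).
Notation i0 := (lshift k (0 : 'I_k)).
Implicit Types (x v w : V) (a b u : 'rV[R]_k).

Definition deck a b x : V :=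
  x *m block_mx 1%:M 0 0 (dilation a) + row_mx a b.

Lemma lsubmx_deck a b x : lsubmx (deck a b x) = lsubmx x + a.
Proof. by rewrite lsubmx_block mulmx1. Qed.
Lemma rsubmx_deck a b x : rsubmx (deck a b x) = rsubmx x *m dilation a + b.
Proof. exact: rsubmx_block. Qed.

Lemma dilationD a b : dilation (a + b) = dilation a *m dilation b.
Proof.
rewrite /dilation mulmx_diag; congr diag_mx; apply/rowP => j.
by rewrite !mxE weightD opprD expRD.
Qed.
Lemma dilation0 : dilation 0 = 1%:M :> 'M[R]_k.
Proof.
by apply/matrixP => i j; rewrite !mxE weight0 oppr0 expR0.
Qed.

Lemma deck0 x : deck 0 0 x = x.
Proof.
by rewrite -[LHS]hsubmxK lsubmx_deck rsubmx_deck dilation0 mulmx1 !addr0 hsubmxK.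
Qed.
Lemma deckD a b a' b' x :
  deck a' b' (deck a b x) = deck (a + a') (b *m dilation a' + b') x.
Proof.
rewrite -[LHS]hsubmxK -[RHS]hsubmxK !lsubmx_deck !rsubmx_deck dilationD.
by rewrite mulmxDl !addrA mulmxA.
Qed.

Lemma first_coordE x : x 0 i0 = lsubmx x 0 0.
Proof. by rewrite mxE. Qed.

Lemma deck_first a b x : base_lattice a -> (deck a b x) 0 i0 = x 0 i0.
Proof.
by move=> [a0 _ _]; rewrite !first_coordE lsubmx_deck [LHS]mxE a0 addr0.
Qed.

Lemma deck_continuous a b : continuous (deck a b).
Proof. exact: affine_continuous. Qed.

Lemma closed_discrete_near (T U : topologicalType) (A : set U) (f : T -> U) (p : T) :
  closed_discrete A -> {for p, continuous f} ->
  \forall q \near p, A (f q) -> f q = f p.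
Proof. by move=> dA cf; exact: (cf _ (dA (f p))). Qed.

Definition orbit_rel x x' := exists a b,
  [/\ base_lattice a, fiber_lattice b & x' = deck a b x].

Lemma orbit_refl x : orbit_rel x x.
Proof.
by exists 0, 0; rewrite deck0; split=> //; [exact: base_lattice0|exact: fiber_lattice0].
Qed.
Lemma orbit_trans x y w : orbit_rel x y -> orbit_rel y w -> orbit_rel x w.
Proof.
move=> [a [b [al bl ->]]] [a' [b' [al' bl' ->]]].
exists (a + a'), (b *m dilation a' + b'); rewrite deckD; split=> //.
  exact: base_latticeD.
by apply: fiber_latticeD => //; exact: fiber_lattice_dilation.
Qed.
Lemma orbit_sym x y : orbit_rel x y -> orbit_rel y x.
Proof.
move=> [a [b [al bl ->]]]; exists (- a), (- (b *m dilation (- a))); split.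
- exact: base_latticeN.
- by apply/fiber_latticeN/fiber_lattice_dilation => //; exact: base_latticeN.
- by rewrite deckD !subrr deck0.
Qed.

(** Near a given pair of points a single deck transformation accounts for
all the related pairs, and it also relates the given pair. This yields both the
local injectivity of the projection and the separation of orbits. *)
Lemma orbit_local x x' : \forall p \near (x, x'), orbit_rel p.1 p.2 ->
  orbit_rel x x' /\
  p.2 = deck (lsubmx x' - lsubmx x)
             (rsubmx x' - rsubmx x *m dilation (lsubmx x' - lsubmx x)) p.1.
Proof.
set a := lsubmx x' - lsubmx x; set b := rsubmx x' - _.
pose fa (p : V * V) : 'rV[R]_k := lsubmx p.2 - lsubmx p.1.
pose fb (p : V * V) : 'rV[R]_k := rsubmx p.2 - rsubmx p.1 *m dilation a.
have ca : {for (x, x'), continuous fa}.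
  apply: cvgB.
    by apply: cvg_comp; [exact: cvg_snd|exact: continuous_lsubmx].
  by apply: cvg_comp; [exact: cvg_fst|exact: continuous_lsubmx].
have cb : {for (x, x'), continuous fb}.
  apply: cvgB.
    by apply: cvg_comp; [exact: cvg_snd|exact: continuous_rsubmx].
  apply: (cvg_comp (fun p : V * V => rsubmx p.1) (fun y : 'rV[R]_k => y *m dilation a)).
    by apply: cvg_comp; [exact: cvg_fst|exact: continuous_rsubmx].
  exact: mulmx_continuous.
have na := closed_discrete_near (@base_lattice_discrete R k') ca.
have nb := closed_discrete_near (@fiber_lattice_discrete R k') cb.
apply: filterS2 na nb => -[y y'] Ha Hb [a' [b' [al' bl' E]]].
have aE : lsubmx y' - lsubmx y = a' by rewrite [y']E lsubmx_deck addrC addKr.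
have {}Ha : a' = a by rewrite -aE; apply: Ha; rewrite /fa/= aE.
have bE : rsubmx y' - rsubmx y *m dilation a = b'.
  by rewrite [y']E rsubmx_deck Ha addrC addKr.
have {}Hb : b' = b by rewrite -bE; apply: Hb; rewrite /fb/= bE.
split; last by rewrite /= [y']E Ha Hb.
exists a, b; split; [by rewrite -Ha|by rewrite -Hb|].
rewrite -[LHS]hsubmxK -[RHS]hsubmxK lsubmx_deck rsubmx_deck /b /a.
by congr row_mx; rewrite addrC subrK.
Qed.

Definition strip : set V := [set x | 0 <= x 0 i0 <= 2].

Definition clamp_coord (r : R) : R := Num.min 2 (Num.max 0 r).
(** A continuous retraction onto the strip. It allows the quotient of the
strip to be taken as a quotient of the whole vector space. *)
Definition clamp x : V :=
  x + (clamp_coord (x 0 i0) - x 0 i0) *: delta_mx 0 i0.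

Lemma clamp_first x : clamp x 0 i0 = clamp_coord (x 0 i0).
Proof. by rewrite !mxE !eqxx mulr1 addrC subrK. Qed.
Lemma clamp_strip x : strip (clamp x).
Proof.
by rewrite /strip/= clamp_first le_min ge_min le_max lexx/= ler0n lexx.
Qed.
Lemma clamp_id x : strip x -> clamp x = x.
Proof.
move=> /andP[x0 x2]; rewrite /clamp /clamp_coord max_r// min_r//.
by rewrite subrr scale0r addr0.
Qed.
Lemma clamp_continuous : continuous clamp.
Proof.
move=> x.
have c : {for x, continuous (fun y : V => y 0 i0 : R^o)} by exact: coord_continuous.
have cc : {for x, continuous (fun y : V => clamp_coord (y 0 i0) : R^o)}.
  apply: (@continuous_min R V (cst 2) (cst 0 \max (fun y : V => y 0 i0))).
    exact: cst_continuous.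
  by apply: continuous_max; [exact: cst_continuous|exact: c].
have FF := nbhs_filter x.
exact: (@cvgD R V _ _ FF id _ x _ (@cvg_id _ (nbhs x))
  (cvgZr_tmp (a := delta_mx 0 i0 : V) (cvgB cc c))).
Qed.

End Deck.
Arguments strip {R k'}.

(** * The quotient of the strip *)

Section Quotient.
Variables (R : realType) (k' : nat).
Notation k := k'.+1.
Notation V := 'rV[R]_(k + k).
Notation i0 := (lshift k (0 : 'I_k)).
Implicit Types (x v w : V) (a b u : 'rV[R]_k).

Definition orbit_eq x y : bool := `[< orbit_rel (clamp x) (clamp y) >].
Lemma orbit_eq_refl : reflexive orbit_eq.
Proof. by move=> x; apply/asboolP; exact: orbit_refl. Qed.
Lemma orbit_eq_sym : symmetric orbit_eq.
Proof. by move=> x y; apply/asboolP/asboolP; exact: orbit_sym. Qed.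
Lemma orbit_eq_trans : transitive orbit_eq.
Proof. by move=> y x z /asboolP xy /asboolP yz; apply/asboolP; exact: orbit_trans xy yz. Qed.

Canonical orbit_equiv := EquivRel orbit_eq orbit_eq_refl orbit_eq_sym orbit_eq_trans.

Definition total_space : topologicalType := quotient_topology {eq_quot orbit_equiv}%qT.

Definition pr : V -> total_space := \pi_({eq_quot orbit_equiv})%qT.

Lemma prP x y : pr x = pr y <-> orbit_rel (clamp x) (clamp y).
Proof.
split=> [/eqmodP/asboolP//|H]; apply/eqmodP; exact/asboolP.
Qed.

Lemma pr_continuous : continuous pr.
Proof. exact: pi_continuous. Qed.

Lemma pr_open (A : set total_space) : open (pr @^-1` A) -> open A.
Proof. by []. Qed.

Lemma pr_stripP x y : strip x -> strip y -> pr x = pr y <-> orbit_rel x y.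
Proof. by move=> sx sy; rewrite prP !clamp_id. Qed.

Lemma pr_clamp x : pr (clamp x) = pr x.
Proof. apply/prP; rewrite (clamp_id (clamp_strip x)); exact: orbit_refl. Qed.

Lemma pr_surj (p : total_space) : exists2 x, strip x & pr x = p.
Proof.
exists (clamp (repr (p : {eq_quot orbit_equiv}%qT))); first exact: clamp_strip.
by rewrite pr_clamp /pr reprK.
Qed.

Lemma deck_strip a b x : base_lattice a -> strip x -> strip (deck a b x).
Proof. by move=> al; rewrite /strip/= deck_first. Qed.

Lemma pr_deck a b x : base_lattice a -> fiber_lattice b -> strip x ->
  pr (deck a b x) = pr x.
Proof.
move=> al bl sx; apply/pr_stripP => //; first exact: deck_strip.
by apply: orbit_sym; exists a, b.
Qed.

(** The saturation of an open set under the deck transformations is a union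
of open sets. *)
Lemma pr_image_open (U : set V) : open U -> open (pr @` (U `&` strip)).
Proof.
move=> oU; apply: pr_open.
have -> : pr @^-1` (pr @` (U `&` strip)) =
    \bigcup_(ab in [set ab | base_lattice ab.1 /\ fiber_lattice ab.2])
      ((deck ab.1 ab.2 \o @clamp R k') @^-1` U).
  apply/seteqP; split=> x /=.
    move=> [y [Uy sy] /esym/prP]; rewrite (clamp_id sy) => -[a [b [al bl E]]].
    by exists (a, b) => //=; rewrite -E.
  move=> [[a b] /= [al bl] Ux]; exists (deck a b (clamp x)).
    by split=> //; apply: deck_strip => //; exact: clamp_strip.
  by rewrite pr_deck// ?pr_clamp//; exact: clamp_strip.
apply: bigcup_open => -[a b] /= _; apply: open_comp => // x _.
by apply: continuous_comp; [exact: clamp_continuous|exact: deck_continuous].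
Qed.

(** If two points are not related, no two points near them are, and the
images of these neighborhoods are disjoint. *)
Lemma total_space_hausdorff : hausdorff_space total_space.
Proof.
move=> p q; have [x sx <-] := pr_surj p; have [y sy <-] := pr_surj q => cl.
apply/pr_stripP => //; apply: contrapT => nxy.
have : \forall z \near (x, y), ~ orbit_rel z.1 z.2.
  by apply: filterS (@orbit_local R k' x y) => z H /H[].
move=> [[A B] /= [nA nB] AB].
rewrite nbhsE in nA; rewrite nbhsE in nB.
case: nA => A' [oA A'x] sA; case: nB => B' [oB B'y] sB.
have NA : nbhs (pr x) (pr @` (A' `&` strip)).
  by apply: open_nbhs_nbhs; split; [exact: pr_image_open|exists x].
have NB : nbhs (pr y) (pr @` (B' `&` strip)).
  by apply: open_nbhs_nbhs; split; [exact: pr_image_open|exists y].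
have [_ [[u [Au su] <-] [v [Bv sv] /esym/(pr_stripP su sv)]]] := cl _ _ NA NB.
by apply: (AB (u, v)); split=> /=; [exact: sA|exact: sB].
Qed.

Lemma second_countable_rV m : @second_countable 'rV[R]_m.
Proof.
exists (range (fun qn : 'rV[rat]_m * nat =>
    ball (map_mx ratr qn.1 : 'rV[R]_m) (qn.2.+1%:R^-1 : R))).
  exact: sub_countable (card_image_le _ _) (countableP _).
split=> [_ [[q n] _ <-]|x N /nbhs_ballP[e /= e0 eN]].
  by apply: ball_open => /=; rewrite invr_gt0.
have [n _ /(_ n (leqnn n))/= ne] :=
  near_infty_natSinv_lt (PosNum (divr_gt0 e0 (ltr0Sn R 1))).
set r : R := n.+1%:R^-1 in ne.
have r0 : 0 < r by rewrite invr_gt0.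
have /choice[q qx] : forall i : 'I_m, exists q : rat, ratr q \in `](x 0 i - r), (x 0 i + r)[.
  by move=> i; apply: rat_in_itvoo; lra.
have xq : ball x r (map_mx ratr (\row_i q i) : 'rV[R]_m).
  split=> // i j; rewrite ord1 !mxE /ball/= ltr_distl.
  by have := qx j; rewrite in_itv/= => /andP[? ?]; apply/andP; split; lra.
exists (ball (map_mx ratr (\row_i q i) : 'rV[R]_m) r) => /=.
  split; last exact: ball_sym.
  by exists (\row_i q i, n).
move=> y qy; apply: eN; apply: (@le_ball _ _ x (r + r)); first by lra.
exact: ball_triangle xq qy.
Qed.

Lemma total_space_second_countable : @second_countable total_space.
Proof.
have [B cB [Bo Bx]] := @second_countable_rV (k + k).
exists ((fun U => pr @` (U `&` strip)) @` B); 
  first exact: sub_countable (card_image_le _ _) cB.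
split=> [_ [U BU <-]|p N Np]; first exact/pr_image_open/Bo.
have [x sx E] := pr_surj p; rewrite -E in Np *.
have Nx : nbhs x (pr @^-1` N) by exact: pr_continuous.
have [U [BU Ux] UN] := Bx x _ Nx.
exists (pr @` (U `&` strip)) => /=; last by move=> _ [y [Uy _] <-]; exact: UN.
by split; [exists U|exists x].
Qed.

(** Both lattices are cocompact, so a box of their basis coordinates is sent
onto the quotient. *)
Lemma total_space_compact : compact [set: total_space].
Proof.
pose box : set V := [set v | forall i, `[(0:R), 2]%classic (v ord0 i)].
have cbox : compact box.
  apply: (@rV_compact R (k + k) (fun=> `[0, 2]%classic)) => i.
  exact: segment_compact.
pose G (x : V) := pr (x *m block_mx (log_unit_mx R k') 0 0 (vandermonde R k')).
have -> : [set: total_space] = G @` box.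
  apply/seteqP; split=> // p _; have [x sx <-] := pr_surj p.
  have u02 : 0 <= lsubmx x 0 0 <= 2 by rewrite -first_coordE.
  have [a al [z z02 Ez]] := base_lattice_cocompact u02.
  have [b bl [q q01 Eq]] := fiber_lattice_cocompact (rsubmx x *m dilation (- a)).
  exists (row_mx z q).
    move=> i /=; rewrite in_itv/=; case: (split_ordP i) => j ->.
      by rewrite row_mxEl z02.
    by rewrite row_mxEr; have /andP[-> /le_trans] := q01 j; apply; rewrite ler1n.
  rewrite /G; transitivity (pr (deck (- a) (- b) x)); last first.
    by apply: pr_deck => //; [exact: base_latticeN|exact: fiber_latticeN].
  congr pr; rewrite -[RHS]hsubmxK lsubmx_deck rsubmx_deck Eq Ez !addrK.
  by rewrite mul_row_block !mulmx0 addr0 add0r.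
apply: continuous_compact => //; apply: continuous_subspaceT => x.
by apply: continuous_comp; [exact: mulmx_continuous|exact: pr_continuous].
Qed.

Lemma total_space_connected : connected [set: total_space].
Proof.
have -> : [set: total_space] =
    \bigcup_(x in [set: V]) ((fun t : R => pr (t *: x)) @` `[0, 1]).
  apply/seteqP; split=> // p _; have [x _ <-] := pr_surj p.
  by exists x => //; exists 1; rewrite ?scale1r//= in_itv/= ler01 lexx.
apply: bigcup_connected.
  by exists (pr 0) => x _; exists 0; rewrite ?scale0r//= in_itv/= ler01 lexx.
move=> x _; apply: connected_continuous_connected; first exact: segment_connected.
apply: continuous_subspaceT => t; apply: continuous_comp; last exact: pr_continuous.
exact: scalel_continuous.
Qed.

End Quotient.
Arguments pr {R k'}.

(** * The atlas *)

Section Charts.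
Variables (R : realType) (k' : nat).
Notation k := k'.+1.
Notation V := 'rV[R]_(k + k).
Notation i0 := (lshift k (0 : 'I_k)).
Notation Z := (total_space R k').
Implicit Types (x v w : V) (a b u : 'rV[R]_k) (s : bool) (U : set V).

(** The boolean tells near which end of the strip a chart lives: the
identity is used for the end [u_0 = 0] and the flip for the end [u_0 = 2]. In
both cases the first coordinate of the chart is the distance to that end. *)
Definition end_mx s : 'M[R]_(k + k) :=
  if s then block_mx (flip_mx R k') 0 0 (flip_mx R k') else 1%:M.
Definition end_shift s : V := if s then row_mx (flip_shift R k') 0 else 0.
Definition end_map s v : V := v *m end_mx s + end_shift s.

Lemma end_map_first s v : end_map s v 0 i0 = if s then 2 - v 0 i0 else v 0 i0.
Proof.
rewrite /end_map /end_mx /end_shift; case: s; last by rewrite mulmx1 addr0.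
rewrite !first_coordE lsubmx_block /flip_mx mul_mx_diag !mxE eqxx.
by rewrite mulrN1 addrC.
Qed.

Lemma flip_mxK : flip_mx R k' *m flip_mx R k' = 1%:M.
Proof.
rewrite /flip_mx mulmx_diag -diag_const_mx; congr diag_mx.
by apply/rowP => j; rewrite !mxE; case: (j == 0); rewrite ?mulr1// mulrNN mulr1.
Qed.

Lemma end_mapK s : involutive (end_map s).
Proof.
move=> v; rewrite /end_map /end_mx /end_shift; case: s; last by rewrite !mulmx1 !addr0.
rewrite -[LHS]hsubmxK !lsubmx_block !rsubmx_block !addr0 -mulmxA flip_mxK mulmx1.
rewrite mulmxDl -mulmxA flip_mxK mulmx1 -addrA.
suff -> : flip_shift R k' *m flip_mx R k' + flip_shift R k' = 0 by rewrite addr0 hsubmxK.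
apply/rowP => j; rewrite /flip_mx mul_mx_diag !mxE.
by case: (j == 0); rewrite ?mul0r ?addr0// mulrN1 addNr.
Qed.

Lemma end_map_continuous s : continuous (end_map s).
Proof. exact: affine_continuous. Qed.

Lemma end_map_symmetry s : liouville_symmetry (end_mx s) (end_shift s).
Proof.
rewrite /end_mx /end_shift; case: s; first exact: flip_symmetry.
by split=> x; rewrite ?trmx1 ?mulmx1 ?mul1mx addr0.
Qed.

Lemma half_spaceE v : half_space v <-> 0 <= v 0 i0.
Proof.
split=> [/(_ i0)|v0 i ii0]; first exact.
by rewrite (_ : i = i0)//; apply: val_inj.
Qed.

Lemma end_map_strip s v : strip v -> strip (end_map s v).
Proof. by rewrite /strip/= end_map_first; case: s => // /andP[? ?]; apply/andP; split; lra. Qed.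

Definition end_pr s v : Z := pr (end_map s v).

Lemma end_pr_continuous s : continuous (end_pr s).
Proof.
move=> x; apply: continuous_comp; [exact: end_map_continuous|exact: pr_continuous].
Qed.

(** Charts must stay away from the opposite end, which is not part of the
boundary of the half-space. *)
Definition below U := forall v, U v -> v 0 i0 < 2.

Lemma below_strip U v : below U -> U v -> half_space v -> strip v.
Proof. by move=> bU /bU v2 /half_spaceE v0; rewrite /strip/= v0 ltW. Qed.

Lemma end_pr_open s U : open U -> below U -> open (end_pr s @` (U `&` half_space)).
Proof.
move=> oU bU.
have -> : end_pr s @` (U `&` half_space) = pr @` ((end_map s @^-1` U) `&` strip).
  apply/seteqP; split=> _ [v [Uv hv] <-].
    exists (end_map s v) => //; split; first by rewrite /= end_mapK.
    exact/end_map_strip/(below_strip bU).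
  exists (end_map s v); last by rewrite /end_pr end_mapK.
  by split=> //; apply/half_spaceE; have /andP[] := end_map_strip s hv.
apply: pr_image_open; apply: open_comp => // x _; exact: end_map_continuous.
Qed.

(** An open set on whose trace on the half-space the projection is
injective; the corresponding chart is the inverse of that restriction. *)
Record chart_domain := ChartDomain {
  cd_end : bool;
  cd_set : set V;
  cd_open : open cd_set;
  cd_below : below cd_set;
  cd_inj : forall v w, cd_set v -> cd_set w -> half_space v -> half_space w ->
    end_pr cd_end v = end_pr cd_end w -> v = w }.

Section OneChart.
Variable c : chart_domain.
Definition cd_range : set V := cd_set c `&` half_space.
Definition cd_dom : set Z := end_pr (cd_end c) @` cd_range.
Definition cd_map (p : Z) : V := xget 0 [set v | cd_range v /\ end_pr (cd_end c) v = p].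

Lemma cd_mapP p : cd_dom p -> cd_range (cd_map p) /\ end_pr (cd_end c) (cd_map p) = p.
Proof. by move=> [v rv E]; rewrite /cd_map; case: xgetP => // /(_ v); case. Qed.

Lemma cd_map_pr v : cd_range v -> cd_map (end_pr (cd_end c) v) = v.
Proof.
move=> rv; have [[dw hw] E] := @cd_mapP (end_pr (cd_end c) v) (ex_intro2 _ _ v rv erefl).
by case: rv => dv hv; apply: (@cd_inj c).
Qed.

Lemma cd_dom_open : open cd_dom.
Proof. by apply: end_pr_open; [exact: cd_open|exact: cd_below]. Qed.

Lemma cd_map_image : cd_map @` cd_dom = cd_range.
Proof.
apply/seteqP; split=> v; first by move=> [p /cd_mapP[r _] <-].
by move=> rv; exists (end_pr (cd_end c) v); [exists v|exact: cd_map_pr].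
Qed.

Lemma cd_map_continuous : {within cd_dom, continuous cd_map}.
Proof.
rewrite continuous_open_subspace; last exact: cd_dom_open.
move=> p /set_mem dp; have [[cv hv] E] := cd_mapP dp.
move=> N; rewrite nbhsE => -[B [oB Bv] BN].
apply: (@filterS _ (nbhs p) _ (end_pr (cd_end c) @` ((cd_set c `&` B) `&` half_space))).
  by move=> _ [v [[cdv Bv'] hv'] <-] /=; rewrite cd_map_pr//; exact: BN.
apply: open_nbhs_nbhs; split; last by exists (cd_map p).
apply: end_pr_open; first by apply: openI => //; exact: cd_open.
by move=> v [/cd_below].
Qed.

Lemma cd_range_open : exists2 W : set V, open W & cd_map @` cd_dom = W `&` half_space.
Proof. by exists (cd_set c); [exact: cd_open|rewrite cd_map_image]. Qed.

Definition cd_chart : chart R (k + k) Z :=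
  @Chart R (k + k) Z cd_dom cd_map (end_pr (cd_end c)) cd_dom_open
    (fun p dp => (cd_mapP dp).2) cd_range_open cd_map_continuous
    (continuous_subspaceT (@end_pr_continuous (cd_end c))).

End OneChart.

(** Applied to a point and itself, the local description of the orbit
relation only leaves the identity, so the projection is locally injective. *)
Lemma chart_domain_at s v : v 0 i0 < 2 ->
  exists c : chart_domain, cd_end c = s /\ cd_set c v.
Proof.
move=> v2; pose x := end_map s v.
have : \forall z \near (x, x), orbit_rel z.1 z.2 -> z.2 = z.1.
  apply: filterS (@orbit_local R k' x x) => z H /H[_].
  by rewrite subrr dilation0 mulmx1 subrr deck0.
move=> [[A B] /= [nA nB] AB].
have nU : nbhs v ((end_map s @^-1` (A `&` B)) `&` [set w : V | w 0 i0 < 2]).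
  apply: filterI; first by apply: end_map_continuous; exact: filterI.
  exact: (@coord_continuous R 1 (k + k) 0 i0 v _ (lt_nbhsl v2)).
move: nU; rewrite nbhsE => -[U [oU Uv] sU].
have bU : below U by move=> w /sU[].
have iU w w' : U w -> U w' -> half_space w -> half_space w' ->
    end_pr s w = end_pr s w' -> w = w'.
  move=> Uw Uw' hw hw'; have sw := below_strip bU Uw hw; have sw' := below_strip bU Uw' hw'.
  move/(pr_stripP (end_map_strip s sw) (end_map_strip s sw')) => /(AB (_, _)) /= E.
  have [[[Aw _] _] [[_ Bw'] _]] := (sU _ Uw, sU _ Uw').
  by rewrite -[w](end_mapK s) -[w'](end_mapK s) E.
by exists (@ChartDomain s U oU bU iU).
Qed.

Definition cd_atlas : set (chart R (k + k) Z) := range cd_chart.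

Lemma cd_atlas_cover p : exists2 c, cd_atlas c & chart_dom c p.
Proof.
have [x /andP[x0 x2] <-] := pr_surj p.
have [x2'|x2'] := ltP (x 0 i0) 2.
  have [c [cs cx]] := chart_domain_at false x2'.
  exists (cd_chart c); first by exists c.
  exists x; first by split=> //; exact/half_spaceE.
  by rewrite cs /end_pr /end_map mulmx1 addr0.
have v0 : end_map true x 0 i0 = 0 by rewrite end_map_first; lra.
have [|c [cs cx]] := @chart_domain_at true (end_map true x); first by rewrite v0.
exists (cd_chart c); first by exists c.
exists (end_map true x); first by split=> //; apply/half_spaceE; rewrite v0.
by rewrite cs /end_pr end_mapK.
Qed.

Lemma cd_range_strip c v : cd_range c v -> strip v.
Proof. by case=> ? ?; exact: (below_strip (@cd_below c)). Qed.

(** Two charts at a point differ by the flips of their ends and one deck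
transformation, which are symmetries. The equality persists nearby since the
image of this composite map stays in the domain of the second chart. *)
Lemma transition_affine (c c' : chart R (k + k) Z) p : cd_atlas c -> cd_atlas c' ->
  chart_dom c p -> chart_dom c' p ->
  exists M d, liouville_symmetry M d /\
    \forall w \near chart_map c p, half_space w -> transition c c' w = w *m M + d.
Proof.
move=> [e _ <-] [e' _ <-] /= dp dp'.
have [rv pv] := cd_mapP dp; have [rv' pv'] := cd_mapP dp'.
set v := cd_map e p in rv pv *; set v' := cd_map e' p in rv' pv'.
have sv := end_map_strip (cd_end e) (cd_range_strip rv).
have sv' := end_map_strip (cd_end e') (cd_range_strip rv').
have /(pr_stripP sv sv')[a [b [al bl E]]] : end_pr (cd_end e) v = end_pr (cd_end e') v'.
  by rewrite pv pv'.
pose F w := end_map (cd_end e') (deck a b (end_map (cd_end e) w)).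
have Fv : F v = v' by rewrite /F -E end_mapK.
have cF : continuous F.
  move=> w; apply: (@continuous_comp _ _ _ (fun w => deck a b (end_map (cd_end e) w))).
    by apply: continuous_comp; [exact: end_map_continuous|exact: deck_continuous].
  exact: end_map_continuous.
have S := liouville_symmetry_comp (liouville_symmetry_comp (end_map_symmetry (cd_end e))
  (deck_symmetry b (let: And3 a0 _ _ := al in a0))) (end_map_symmetry (cd_end e')).
eexists; eexists; split; first exact: S.
have nV : nbhs v (cd_set e) by apply: open_nbhs_nbhs; split; [exact: cd_open|case: rv].
(* F is the candidate for the transition near v; it sends v to v', which lies
   in the domain of the second chart. *)
have nV' : nbhs v (F @^-1` cd_set e').
  apply: cF; rewrite Fv; apply: open_nbhs_nbhs; split; [exact: cd_open|by case: rv'].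
apply: filterS2 nV nV' => w Vw Vw' hw.
transitivity (F w); last first.
  by rewrite /F /end_map /deck !mulmxDl !mulmxA !addrA.
have sw : strip (end_map (cd_end e) w).
  by apply: end_map_strip; apply: (@cd_range_strip e).
have sFw : strip (F w) by apply/end_map_strip/deck_strip.
rewrite /transition /= -(_ : end_pr (cd_end e') (F w) = end_pr (cd_end e) w).
  by rewrite cd_map_pr//; split=> //; apply/half_spaceE; case/andP: sFw.
by rewrite /end_pr /F end_mapK pr_deck.
Qed.

Lemma chart_map_half_space (c : chart R (k + k) Z) p : cd_atlas c -> chart_dom c p ->
  half_space (chart_map c p).
Proof. by move=> [e _ <-] /cd_mapP[[]]. Qed.

Lemma cd_atlas_compatible c c' : cd_atlas c -> cd_atlas c' ->
  smooth_on (chart_map c @` (chart_dom c `&` chart_dom c')) (transition c c').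
Proof.
move=> ac ac' _ [p [dp dp'] <-].
have [M [d [_ ]]] := transition_affine ac ac' dp dp'.
rewrite /prop_near1 nbhsE => -[U [oU Up] UT].
exists U, (fun x => x *m M + d); split=> //.
  by move=> n; apply: elementary_Ck => i j; exact: elementary_affine.
move=> _ [q [dq dq'] <-] /UT ->//; exact: chart_map_half_space.
Qed.

Definition liouville_manifold : manifold R (k + k) :=
  @Manifold R (k + k) Z cd_atlas (@total_space_hausdorff R k')
    (@total_space_second_countable R k') cd_atlas_cover cd_atlas_compatible.

End Charts.

(** * The contact boundary *)

Section LiouvilleManifold.
Variables (R : realType) (k' : nat).
Notation k := k'.+1.
Notation V := 'rV[R]_(k + k).
Notation i0 := (lshift k (0 : 'I_k)).
Notation Z := (liouville_manifold R k').

Lemma liouville_manifold_symplectic :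
  @symplectic R (k + k) Z (fun _ => @symplectic_form R k').
Proof.
split; first split.
- by move=> c _; apply: elementary_smooth; exact: elementary_symplectic_form.
- by move=> c p _ _; exact: symplectic_form_skew.
- move=> c c' p ac ac' dp dp'.
  have [M [d [[S _] T]]] := transition_affine ac ac' dp dp'.
  have hp := chart_map_half_space ac dp.
  move=> J; rewrite /J (Jac_near_affine hp T) {1}S -(nbhs_singleton T hp).
  by rewrite /transition chart_mapK.
- by move=> c p ac dp i j l; apply: symplectic_form_closed; exact: chart_map_half_space.
- by move=> c p _ _; exact: symplectic_form_unit.
Qed.

(** The coordinate [u_0] is invariant under the deck transformations and
therefore descends to the quotient; it separates the two boundary components. *)
Definition first_coord (p : Z) : R := clamp (repr (p : {eq_quot (orbit_equiv R k')}%qT)) 0 i0.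

Lemma first_coord_pr x : first_coord (pr x) = clamp x 0 i0.
Proof.
rewrite /first_coord; have /prP : pr (repr (pr x : {eq_quot (orbit_equiv R k')}%qT)) = pr x.
  by rewrite /pr reprK.
by move=> [a [b [al bl ->]]]; rewrite deck_first.
Qed.

Lemma first_coord_continuous : continuous first_coord.
Proof.
apply/quotient_continuous.
rewrite (_ : _ \o _ = fun x : V => clamp x 0 i0).
  move=> x; apply: (cvg_comp (@clamp R k') (fun x : V => x 0 i0)).
    exact: clamp_continuous.
  exact: coord_continuous.
by apply/funext => x; exact: first_coord_pr.
Qed.

Lemma first_coord_chart (e : chart_domain R k') p : cd_dom e p ->
  first_coord p = if cd_end e then 2 - cd_map e p 0 i0 else cd_map e p 0 i0.
Proof.
move=> dp; have [rv pv] := cd_mapP dp.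
rewrite -{1}pv first_coord_pr clamp_id ?end_map_first//.
exact: end_map_strip (cd_range_strip rv).
Qed.

(** The first coordinate of a chart is the distance to its end of the strip,
so a boundary point lies over one of the two ends. *)
Lemma boundary_first_coord p : boundary Z p -> first_coord p = 0 \/ first_coord p = 2.
Proof.
move=> [c [[e _ <-] dp [i ii0 pi0]]]; rewrite (first_coord_chart dp).
have E : i = i0 by apply: val_inj.
rewrite E /= in pi0; rewrite pi0 subr0.
by case: (cd_end e); [right|left].
Qed.

Lemma liouville_manifold_contact_type :
  @boundary_of_contact_type R (k + k) Z (fun _ => @symplectic_form R k').
Proof.
exists setT, (fun _ => @liouville_field R k'); split=> //; first exact: openT.
- split; first by move=> c _; apply: elementary_smooth; exact: elementary_liouville_field.
  move=> c c' p ac ac' dp dp' _.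
  have [M [d [[_ S] T]]] := transition_affine ac ac' dp dp'.
  have hp := chart_map_half_space ac dp.
  rewrite (Jac_near_affine hp T) -S; congr liouville_field.
  by rewrite -(nbhs_singleton T hp) /transition chart_mapK.
- move=> c p ac dp _; have hp := chart_map_half_space ac dp.
  by rewrite contract_liouville d1_liouville_form// Lie_liouville_field.
- move=> c p [e _ <-] dp bp i ii0; have [rv _] := cd_mapP dp.
  have -> : i = i0 by apply: val_inj.
  apply: liouville_field_inward; have := first_coord_chart dp.
  have := cd_below rv.1; rewrite /=.
  case: (boundary_first_coord bp) => -> v2; case: (cd_end e) => E; lra.
Qed.

Lemma liouville_manifold_boundary_disconnected : ~ connected (boundary Z).
Proof.
have bend s : exists2 p, boundary Z p & first_coord p = if s then 2 else 0.
  have z2 : (0 : V) 0 i0 < 2 by rewrite mxE.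
  have h0 : half_space (0 : V) by move=> i _; rewrite mxE.
  have [c [cs c0]] := chart_domain_at s z2.
  exists (end_pr s (0 : V)).
    exists (cd_chart c); split=> /=; first by exists c.
      by exists 0; rewrite ?cs.
    by rewrite -cs cd_map_pr//; exists i0; rewrite ?mxE.
  rewrite first_coord_pr clamp_id ?end_map_first ?mxE ?subr0//.
  by apply: end_map_strip; rewrite /strip/= mxE lexx ler0n.
move=> cb.
have /connected_intervalP itv : connected (first_coord @` boundary Z).
  apply: connected_continuous_connected => //.
  by apply: continuous_subspaceT; exact: first_coord_continuous.
have [p bp p0] := bend false; have [q bq q2] := bend true.
have [r br r1] : (first_coord @` boundary Z) 1.
  apply: (itv 0 2); [by exists p|by exists q|].
  by rewrite ler01 ler1n.
by have := boundary_first_coord br; rewrite r1 => -[]; lra.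
Qed.

End LiouvilleManifold.

Local Close Scope ring_scope.

Theorem theorem1p1 (R : realType) (n : nat) (n_gt0 : (0 < n)%N) :
  exists (Z : manifold R (4 * n)%N)
         (w : chart R (4 * n)%N Z -> 'rV[R]_(4 * n) -> 'M[R]_(4 * n)),
    [/\ compact [set: Z], connected [set: Z], symplectic w,
        ~ connected (boundary Z) & boundary_of_contact_type w].
Proof.
(* The construction is carried out in dimension k + k with k = k'.+1. *)
have -> : (4 * n = (2 * n).-1.+1 + (2 * n).-1.+1)%N by lia.
exists (liouville_manifold R (2 * n).-1), (fun _ => @symplectic_form R (2 * n).-1); split.
- exact: total_space_compact.
- exact: total_space_connected.
- exact: liouville_manifold_symplectic.
- exact: liouville_manifold_boundary_disconnected.
- exact: liouville_manifold_contact_type.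
Qed.
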